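(* Let $f$ be a nonconstant rational inner function on $\mathbb{D}^n$ of the form $f(z)=z^{\nu(Q)}\widetilde{Q}(\frac{1}{z})/Q(z)$, where $Q\in\mathbb{C}[z_1,\dots,z_n]$ is a nonconstant polynomial such that $Z(Q)\cap\mathbb{D}^n=\emptyset$. Then: (a) There exist a nonconstant polynomial $\mathcal{Q}\in\mathbb{C}[z_1,\dots,z_n]$ with $Z(\mathcal{Q})\cap\mathbb{D}^n=\emptyset$ and a unimodular constant $C$ such that $f$ can also be expressed as $$f(z)=C\,\frac{z^{\nu(\mathcal{Q})}\,\widetilde{\mathcal{Q}}\left(\frac{1}{z}\right)}{\mathcal{Q}(z)},$$ and such that the numerator and the denominator of this expression have no (nonconstant) irreducible polynomial factors in common. (b) With $\mathcal{Q}$ as in (a), there exist rational inner functions $f_1,f_2\in\mathcal{O}(\mathbb{D}^n)$, both nonunits in $\mathcal{O}(\mathbb{D}^n)$, such that $f=f_1f_2$ in $\mathbb{D}^n$ if and only if $\mathcal{Q}$ is reducible in $\mathbb{C}[z_1,\dots,z_n]$.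
   Context: $\mathbb{D}$ is the open unit disc in $\mathbb{C}$, $\mathbb{T}=\partial\mathbb{D}$, $\mathcal{O}(\mathbb{D}^n)$ is the ring of holomorphic functions on $\mathbb{D}^n$, and $Z(Q)\subset\mathbb{C}^n$ is the zero set of $Q$. An inner function on $\mathbb{D}^n$ is a bounded holomorphic function $f$ on $\mathbb{D}^n$ with $\lim_{r\to1^-}|f(rw)|=1$ for almost every $w\in\mathbb{T}^n$; a rational inner function is an inner function that is rational. For $Q(z)=\sum_{\alpha}a_\alpha z^\alpha\in\mathbb{C}[z_1,\dots,z_n]$: $\widetilde{Q}(z):=\sum_\alpha\overline{a_\alpha}z^\alpha$ and $\widetilde{Q}(\frac1z):=\sum_\alpha\overline{a_\alpha}\frac{1}{z^\alpha}$; $\nu(Q):=(\nu_1(Q),\dots,\nu_n(Q))$, where $\nu_j(Q)$ is the degree of $Q(b_1,\dots,b_{j-1},\zeta,b_{j+1},\dots,b_n)\in\mathbb{C}[\zeta]$ for generic $(b_1,\dots,b_{j-1},b_{j+1},\dots,b_n)\in\mathbb{C}^{n-1}$ (i.e. the degree of $Q$ in $z_j$). The expression $z^{\nu(Q)}\widetilde{Q}(\frac1z)$ is a polynomial. *)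

(* Defs.v *)
From HB Require Import structures.
From mathcomp Require Import all_boot all_order all_algebra.
From mathcomp Require Import all_classical all_reals all_analysis.
From mathcomp Require Import complex.
From mathcomp Require mpoly.
(* The notations of multinomials clash with those of mathcomp-analysis. *)
Import -(notations) mpoly.

Set Implicit Arguments.
Unset Strict Implicit.
Unset Printing Implicit Defensive.

Import Order.TTheory GRing.Theory Num.Theory numFieldNormedType.Exports.

Local Open Scope classical_set_scope.
Local Open Scope ring_scope.
Local Open Scope complex_scope.

(* R[i] gets the topology of its norm, in the same way as mathcomp-analysis
   does for abstract numeric fields. *)
#[non_forgetful_inheritance]
HB.instance Definition _ (R : realType) := GRing.ComAlgebra.copy R[i] R[i]^o.
#[non_forgetful_inheritance]
HB.instance Definition _ (R : realType) := Vector.copy R[i] R[i]^o.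
#[non_forgetful_inheritance]
HB.instance Definition _ (R : realType) := NormedModule.copy R[i] R[i]^o.

Section RingElements.
Variable A : idomainType.
Implicit Types p q : A.

Definition irreducible_elt p :=
  [/\ p != 0, p \isn't a GRing.unit &
      forall a b, p = a * b -> a \is a GRing.unit \/ b \is a GRing.unit].

Definition reducible_elt p :=
  [/\ p != 0, p \isn't a GRing.unit &
      exists a b, [/\ a \isn't a GRing.unit, b \isn't a GRing.unit & p = a * b]].

Definition divides p q := exists c, q = p * c.

Definition no_common_irreducible_factor p q :=
  forall d, irreducible_elt d -> ~ (divides d p /\ divides d q).

End RingElements.

Section Polynomials.
Variables (R : realType) (n : nat).
Implicit Types (Q : mpoly n R[i]) (z : 'rV[R[i]]_n).

Definition peval Q z : R[i] := meval (z ord0) Q.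

Definition zero_locus Q : set 'rV[R[i]]_n := [set z | peval Q z = 0].

Definition nonconstant_poly Q := ~ exists c, Q = mpolyC n c.

Definition degree_in Q (j : 'I_n) : nat := (\max_(m <- msupp Q) m j)%N.

Definition nu Q : multinom n := Multinom [tuple degree_in Q j | j < n].

Definition conj_poly Q : mpoly n R[i] := map_mpoly Num.conj Q.

(* The polynomial z^nu(Q) * (conj_poly Q)(1/z); the truncated subtraction of
   exponents is exact because every m in msupp Q is bounded by nu Q.  See
   [reflectionE]. *)
Definition reflection Q : mpoly n R[i] :=
  \sum_(m <- msupp Q) mcoeff m (conj_poly Q) *: mpolyX _ (mnm_sub (nu Q) m).

Lemma le_nu Q m j : m \in msupp Q -> (m j <= nu Q j)%N.
Proof.
move=> mQ; rewrite multinomE tnth_mktuple /degree_in.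
by rewrite (big_rem m mQ) /= leq_maxl.
Qed.

Lemma reflectionE Q z : (forall j, z ord0 j != 0) ->
  peval (reflection Q) z =
  (\prod_(j < n) z ord0 j ^+ nu Q j) *
  peval (conj_poly Q) (\row_j (z ord0 j)^-1).
Proof.
move=> z0; rewrite /peval /reflection raddf_sum /= mevalE.
have sQ : perm_eq (msupp (conj_poly Q)) (msupp Q).
  by apply: msupp_map_mpoly; exact: fmorph_inj.
rewrite (perm_big _ sQ) /= mulr_sumr big_seq [RHS]big_seq.
apply: eq_bigr => m mQ; rewrite mevalZ mevalX mulrCA -big_split /=.
congr (_ * _); apply: eq_bigr => j _.
by rewrite mnmBE mxE exprVn expfB_cond // (negbTE (z0 j)) add0n le_nu.
Qed.

End Polynomials.

Section Torus.
Variable R : realType.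

Definition circle_point (t : R) : R[i] := cos t +i* sin t.

Definition torus_point n (t : n.-tuple (measurableTypeR R)) : 'rV[R[i]]_n :=
  \row_j circle_point (tnth t j).

Lemma two_pi_gt0 : 0 < 2 * pi :> R.
Proof. by rewrite mulr_gt0 ?pi_gt0. Qed.

Definition cons_angle n (x : measurableTypeR R * n.-tuple (measurableTypeR R)) :
    n.+1.-tuple (measurableTypeR R) :=
  [the n.+1.-tuple (measurableTypeR R) of x.1 :: x.2].

Lemma measurable_cons_angle n :
  measurable_fun [set: measurableTypeR R * n.-tuple (measurableTypeR R)]
    (@cons_angle n).
Proof. exact: measurable_cons. Qed.

HB.instance Definition _ n :=
  isMeasurableFun.Build _ _ _ _ (@cons_angle n) (@measurable_cons_angle n).

(* Normalized Lebesgue measure on the angles [0, 2 pi]^n; its image under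
   [torus_point] is the normalized Lebesgue (Haar) measure of the torus, so
   "for almost every w in T^n" is stated as "for torus_prob-almost every t",
   with w := torus_point t. *)
Fixpoint torus_prob n : probability (n.-tuple (measurableTypeR R)) R :=
  if n is m.+1 then
    distribution (uniform_prob two_pi_gt0 \x torus_prob m)%E (@cons_angle m)
  else dirac [tuple].

End Torus.

(* Functions on the polydisc are total functions on C^n; only their values on
   the polydisc matter. *)
Section FunctionsOnPolydisc.
Variables (R : realType) (n : nat).
Implicit Types (f g : 'rV[R[i]]_n -> R[i]) (P : mpoly n R[i]).

Definition polydisc : set 'rV[R[i]]_n := [set z | forall j, `|z ord0 j| < 1].

(* [differentiable] is Frechet differentiability over the scalar field R[i],
   i.e. complex differentiability. *)
Definition holomorphic f :=
  forall z, polydisc z -> differentiable f z.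

Definition bounded_on_polydisc f :=
  exists M : R[i], forall z, polydisc z -> `|f z| <= M.

Definition constant_on_polydisc f :=
  exists c, forall z, polydisc z -> f z = c.

Definition inner f :=
  [/\ holomorphic f, bounded_on_polydisc f &
      {ae torus_prob R n, forall t,
        (fun r : R => `|f (r%:C *: torus_point t)|) @ 1^'- --> (1 : R[i])}].

Definition rational f :=
  exists p q : mpoly n R[i], q != 0 /\
    forall z, polydisc z -> peval q z != 0 -> f z = peval p z / peval q z.

Definition rational_inner f := inner f /\ rational f.

Definition unit_holomorphic f :=
  holomorphic f /\
  exists g, holomorphic g /\ forall z, polydisc z -> f z * g z = 1.

Definition zero_free_on_polydisc P := zero_locus P `&` polydisc = set0.

Definition reduced_expression f P :=
  [/\ nonconstant_poly P, zero_free_on_polydisc P &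
      exists C : R[i],
        [/\ `|C| = 1,
            forall z, polydisc z ->
              f z = C * (peval (reflection P) z / peval P z) &
            no_common_irreducible_factor (C *: reflection P) P]].

End FunctionsOnPolydisc.

(* Main.v *)
From HB Require Import structures.
Require Import Defs.
From mathcomp Require Import all_boot all_order all_algebra.
From mathcomp Require Import all_classical all_reals all_analysis.
From mathcomp Require Import measurable_realfun complex ring.
From mathcomp Require mpoly.
Import -(notations) mpoly.

(** Write P~ for the reflection z^nu(P) conj(P)(1/z). Reflection is
    multiplicative, it is an involution on polynomials not vanishing at 0, and
    P~ = z^nu(P) conj(P) on the torus.

    The polynomial ring is factorial (Gauss), and a zero-free denominator Q never
    vanishes at 0. If an irreducible d divides both Q and Q~, then d or d d~
    cancels from both, up to a unimodular constant, and what is left has the same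
    form; by induction on the degree this proves (a)
    ([unimodular_expression_reduces]).

    If the reduced denominator factors as a b, then a~/a and b~/b are the two
    factors of f. They are inner: their modulus is at most 1 on the polydisc
    ([norm_reflection_le], by comparing the extreme coefficients of a zero-free
    polynomial of one variable), and the radial limits have modulus 1 off the zero
    set of the denominator, which is null in the torus ([torus_null]). If a~/a were
    a unit, then a~ would be zero-free too, the bound would hold both ways, and
    |a~| = |a| on the polydisc forces a~ and a to be proportional
    ([zero_free_same_norm]); then f would not be in lowest terms
    ([reflection_quotient_nonunit]).

    Conversely, every rational inner function is c z^m q~/q with q zero-free and
    the fraction in lowest terms ([rational_inner_normal_form]). The point is that
    a polynomial q that divides, with a continuous quotient, a polynomial coprime
    to it has no zeros in the polydisc ([zero_free_quotient]); this is where
    elimination of a variable enters, together with a Harnack inequality for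
    zero-free polynomials ([harnack]). If P is irreducible and f = f1 f2, then P
    divides one of the two denominators, say q1 = P s. Comparing degrees kills the
    monomial factors, and coprimality makes s and q2~ proportional, so that
    f2 = c q2~/q2 is a quotient of zero-free polynomials: a unit
    ([irreducible_divides_factor]).

    Of the holomorphy of f, f1 and f2 only the continuity is used: on polynomials,
    Harnack's inequality along complex lines passes to limits and so plays the part
    of Hurwitz's theorem. *)

Set Implicit Arguments.
Unset Strict Implicit.
Unset Printing Implicit Defensive.

Import Order.TTheory GRing.Theory Num.Theory numFieldNormedType.Exports.

Local Open Scope classical_set_scope.
Local Open Scope ring_scope.
Local Open Scope complex_scope.

(** * Factorial rings *)

Section FactorialRings.
Variable A : idomainType.
Implicit Types a b c d p q : A.

Definition prime_elt p :=
  forall a b, divides p (a * b) -> divides p a \/ divides p b.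

Definition additive_degree (N : A -> nat) :=
  (forall a b, a != 0 -> b != 0 -> N (a * b) = (N a + N b)%N) /\
  (forall a, a != 0 -> N a = 0%N -> a \is a GRing.unit).

(** The degree bounds the length of factorizations, so that inductions over
    prime factors become inductions over a natural number. *)
Definition factorial_ring :=
  (exists N, additive_degree N) /\ forall p, irreducible_elt p -> prime_elt p.

Lemma divides_refl a : divides a a.
Proof. by exists 1; rewrite mulr1. Qed.

Lemma divides_trans b a c : divides a b -> divides b c -> divides a c.
Proof. by move=> [x ->] [y ->]; exists (x * y); rewrite mulrA. Qed.

Lemma dividesMr a b c : divides a b -> divides a (b * c).
Proof. by move=> [x ->]; exists (x * c); rewrite mulrA. Qed.

Lemma dividesMl a b c : divides a b -> divides a (c * b).
Proof. by rewrite mulrC; exact: dividesMr. Qed.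

Lemma dividesD a b c : divides a b -> divides a c -> divides a (b + c).
Proof. by move=> [x ->] [y ->]; exists (x + y); rewrite mulrDr. Qed.

Lemma unit_divides a b : a \is a GRing.unit -> divides a b.
Proof. by move=> ua; exists (a^-1 * b); rewrite mulrA divrr ?mul1r. Qed.

Lemma divides_unit a b : divides a b -> b \is a GRing.unit ->
  a \is a GRing.unit.
Proof. by move=> [x ->]; rewrite unitrM => /andP[]. Qed.

Lemma dividesMI c a b : c != 0 -> divides (c * a) (c * b) -> divides a b.
Proof. by move=> c0 [x]; rewrite -mulrA => /(mulfI c0) ->; exists x. Qed.

Lemma no_common_sym a b :
  no_common_irreducible_factor a b -> no_common_irreducible_factor b a.
Proof. by move=> h d dd [? ?]; apply: (h d dd). Qed.

Lemma no_commonS a a' b b' : divides a' a -> divides b' b ->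
  no_common_irreducible_factor a b -> no_common_irreducible_factor a' b'.
Proof.
move=> aa bb h d dd [da db]; apply: (h d dd).
by split; [exact: divides_trans aa | exact: divides_trans bb].
Qed.

Lemma nonunit_degree N a : additive_degree N -> a != 0 ->
  a \isn't a GRing.unit -> (0 < N a)%N.
Proof.
by move=> [_ N0] a0; rewrite lt0n; apply: contra => /eqP/N0 ->.
Qed.

Lemma exists_irreducible_divisor N a : additive_degree N -> a != 0 ->
  a \isn't a GRing.unit -> exists d, irreducible_elt d /\ divides d a.
Proof.
move=> dN; have [NM _] := dN; have [k] := ubnP (N a).
elim: k a => // k IH a + a0 nua.
have [irr|nirr] := pselect (irreducible_elt a).
  by exists a; split => //; exact: divides_refl.
move=> Nk.
have [b [c [nub nuc e]]] : exists b c,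
    [/\ b \isn't a GRing.unit, c \isn't a GRing.unit & a = b * c].
  apply: contrapT => H; apply: nirr; split => // b c e.
  have [ub|nub] := boolP (b \is a GRing.unit); first by left.
  have [uc|nuc] := boolP (c \is a GRing.unit); first by right.
  by exfalso; apply: H; exists b, c.
have /andP[b0 c0] : (b != 0) && (c != 0).
  by rewrite -negb_or -mulf_eq0 -e.
have [||//|d [dd db]] := IH b.
- move: Nk; rewrite e NM // => Nk.
  have := nonunit_degree dN c0 nuc; move: Nk; rewrite ltnS => Nk c1.
  by apply: leq_trans Nk; rewrite -addn1 leq_add2l.
- by [].
by exists d; split=> //; rewrite e; exact: dividesMr.
Qed.

(** Peeling off the prime factors of the divisor one at a time. *)
Lemma coprime_divides q a b : factorial_ring -> q != 0 ->
  no_common_irreducible_factor q a -> divides q (a * b) -> divides q b.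
Proof.
move=> [[N dN] pr]; have [k] := ubnP (N q).
elim: k q b => // k IH q b Nk q0 cop qab.
have [uq|nuq] := boolP (q \is a GRing.unit); first exact: unit_divides.
have [d [dd [q' e]]] := exists_irreducible_divisor dN q0 nuq.
have da : ~ divides d a by move=> da; apply: (cop d dd); split=> //; exists q'.
have d0 : d != 0 by case: dd.
have q'0 : q' != 0 by move: q0; rewrite e mulf_eq0 negb_or => /andP[].
have [//|[b' eb]] : divides d a \/ divides d b.
  by apply: pr => //; apply: divides_trans qab; exists q'.
rewrite e eb; have [||||x ->] := IH q' b'.
- move: Nk; rewrite e dN.1 // ltnS; apply: leq_trans.
  rewrite -addn1 addnC leq_add2r; apply: nonunit_degree => //.
  by case: dd.
- by [].
- by apply: no_commonS cop; [exists d; rewrite mulrC|exact: divides_refl].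
- by apply: (dividesMI d0); rewrite -e mulrCA -eb.
by exists x; rewrite mulrA.
Qed.

End FactorialRings.

Section PolynomialsOverFactorialRing.
Variable A : idomainType.
Hypothesis factA : factorial_ring A.
Implicit Types (a b c : A) (f g h p q : {poly A}).

Definition primitive_poly h :=
  forall c, irreducible_elt c -> ~ divides c%:P h.

Lemma divides_polyC c h : divides c%:P h <-> forall k, divides c h`_k.
Proof.
split=> [[x ->] k|H]; first by exists x`_k; rewrite coefCM.
have [x hx] := choice H.
exists (\poly_(k < size h) x k); apply/polyP => k; rewrite coefCM coef_poly.
by case: ltnP => [_|hk]; [exact: hx | rewrite mulr0 nth_default].
Qed.

(** At the first coefficients of f and g that c does not divide, the
    coefficient of f g is their product modulo c. *)
Lemma prime_polyC c : prime_elt c -> prime_elt c%:P.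
Proof.
move=> pc f g /divides_polyC cfg.
apply: contrapT => /not_orP[nf ng].
have exmin h : ~ divides c%:P h -> exists k,
    ~ divides c h`_k /\ forall l, (l < k)%N -> divides c h`_l.
  move=> /divides_polyC/existsNP ex.
  have exb : exists k, ~~ `[< divides c h`_k >].
    by have [k nk] := ex; exists k; apply/asboolPn.
  exists (ex_minn exb); case: ex_minnP => m /asboolPn nm minm; split => // l lm.
  apply: contrapT => nl; have := minm l; rewrite leqNgt lm => /(_ _)/negP.
  by case; [exact/asboolPn|].
have [i [nfi fi]] := exmin f nf; have [j [ngj gj]] := exmin g ng.
have := cfg (i + j)%N; rewrite coefM.
have lti : (i < (i + j).+1)%N by rewrite ltnS leq_addr.
rewrite (bigD1 (Ordinal lti)) //= addKn => csum.
have crest : divides c (\sum_(k < (i + j).+1 | k != Ordinal lti)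
                           f`_k * g`_(i + j - k)).
  apply: big_ind => [|x y|k]; first by exists 0; rewrite mulr0.
    exact: dividesD.
  rewrite -val_eqE /= neq_ltn => /orP[ki|ik]; first exact/dividesMr/fi.
  by apply/dividesMl/gj; rewrite ltn_subLR ?ltn_add2r // -ltnS.
have : divides c (f`_i * g`_j).
  case: csum => x ex; case: crest => y ey; exists (x - y).
  by rewrite mulrBr -ex -ey addrK.
by case/pc.
Qed.

(** Constant irreducible factors are split off until none is left, which the
    degree of the leading coefficient bounds. *)
Lemma content h : h != 0 -> exists a h',
  [/\ a != 0, h = a%:P * h' & primitive_poly h'].
Proof.
have [[N dN] _] := factA; have [k] := ubnP (N (lead_coef h)).
elim: k h => // k IH h Nk h0.
have [prim|/existsNP[c /not_implyP[ic /contrapT[g e]]]] :=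
    pselect (primitive_poly h).
  by exists 1, h; split; rewrite ?oner_neq0 // mul1r.
have [c0 nuc _] := ic.
have g0 : g != 0 by move: h0; rewrite e mulf_eq0 negb_or => /andP[].
have [|//|a [h' [a0 eg ph']]] := IH g.
  move: Nk; rewrite e lead_coefM lead_coefC dN.1 ?lead_coef_eq0 // ltnS.
  by apply: leq_trans; rewrite -addn1 addnC leq_add2r (nonunit_degree dN).
by exists (c * a), h'; split; rewrite ?mulf_neq0 // e eg polyCM mulrA.
Qed.

(** Gauss: a prime factor of a divides h or the cofactor, and h is primitive. *)
Lemma primitive_cancel h a g : primitive_poly h -> h != 0 -> a != 0 ->
  divides h (a%:P * g) -> divides h g.
Proof.
have [[N dN] pr] := factA; move=> ph h0; have [k] := ubnP (N a).
elim: k a g => // k IH a g Nk a0 hag.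
have [ua|nua] := boolP (a \is a GRing.unit).
  case: hag => x ex; exists ((a^-1)%:P * x); rewrite mulrCA -ex mulrA -polyCM.
  by rewrite mulVr // mul1r.
have [d [dd [b e]]] := exists_irreducible_divisor dN a0 nua.
have d0 : d != 0 by case: dd.
have b0 : b != 0 by move: a0; rewrite e mulf_eq0 negb_or => /andP[].
case: hag => x ex.
have [/(ph d dd)//|[y ey]] : divides d%:P h \/ divides d%:P x.
  apply: prime_polyC; first exact: pr.
  by rewrite -ex e polyCM -mulrA; exists (b%:P * g).
apply: (IH b g) => //.
  move: Nk; rewrite e dN.1 // ltnS; apply: leq_trans.
  by rewrite -addn1 addnC leq_add2r (nonunit_degree dN) //; case: dd.
apply: (@dividesMI _ d%:P); first by rewrite polyC_eq0.
by exists y; rewrite mulrA -polyCM -e ex ey mulrCA mulrA.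
Qed.

(** Up to a constant, a nonzero combination u p + v q of least degree divides
    p and q: it is their gcd over the fraction field. *)
Lemma bezout_content p q : p != 0 -> exists h a u v,
  [/\ h != 0, primitive_poly h, a != 0, divides h p /\ divides h q &
      a%:P * h = u * p + v * q].
Proof.
move=> p0.
pose S h := h != 0 /\ exists u v, h = u * p + v * q.
have Sp : S p by split=> //; exists 1, 0; rewrite mul1r mul0r addr0.
have exb : exists k, `[< exists h, S h /\ size h = k >].
  by exists (size p); apply/asboolP; exists p.
case: (ex_minnP exb) => m /asboolP[h [[h0 [u [v e]]] sh]] minm.
have [a [h' [a0 eh ph']]] := content h0.
have h'0 : h' != 0 by move: h0; rewrite eh mulf_eq0 negb_or => /andP[].
have dvd g : (exists x y, g = x * p + y * q) -> divides h' g.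
  move=> [x [y eg]].
  have lc0 : lead_coef h ^+ scalp g h != 0 by rewrite expf_neq0 ?lead_coef_eq0.
  apply: (primitive_cancel ph' h'0 lc0).
  have := Pdiv.Idomain.divp_eq g h; rewrite -mul_polyC => E.
  rewrite E.
  have [->|r0] := eqVneq (g %% h) 0.
    by rewrite addr0 eh; exists (g %/ (a%:P * h') * a%:P); rewrite mulrA mulrC.
  have : `[< exists r, S r /\ size r = size (g %% h) >].
    apply/asboolP; exists (g %% h).
    split; last by []. split; first by [].
    exists ((lead_coef h ^+ scalp g h)%:P * x - g %/ h * u).
    exists ((lead_coef h ^+ scalp g h)%:P * y - g %/ h * v).
    rewrite !mulrBl -!mulrA addrACA -mulrDr -eg -opprD -mulrDr -e E.
    by rewrite addrC addKr.
  by move=> /minm; rewrite -sh leqNgt ltn_modp h0.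
exists h', a, u, v; split=> //; last by rewrite -eh.
by split; apply: dvd; [exists 1, 0 | exists 0, 1];
  rewrite mul1r mul0r ?addr0 ?add0r.
Qed.

Lemma irreducible_polyC c : irreducible_elt c%:P -> irreducible_elt c.
Proof.
case=> c0 nuc H; split.
- by rewrite -polyC_eq0.
- by apply: contra nuc => uc; rewrite poly_unitE size_polyC coefC eqxx uc andbT;
    rewrite -polyC_eq0 c0.
move=> a b e; have := H a%:P b%:P; rewrite -polyCM e => /(_ erefl).
by rewrite !poly_unitE !coefC !eqxx => -[] /andP[_]; [left|right].
Qed.

Lemma polyC_unit c : (c%:P \is a GRing.unit) = (c \is a GRing.unit).
Proof.
rewrite poly_unitE size_polyC coefC eqxx.
by have [->|] := eqVneq c 0; rewrite ?unitr0 ?andbF.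
Qed.

(** Let h be the gcd of p and f over the fraction field, made primitive. As it
    divides the irreducible p, either it is associated to p, which then divides f,
    or it is a unit; then a constant multiple of g lies in the ideal (p, f g), and
    the constant cancels since p is primitive. *)
Lemma irreducible_prime_poly p : irreducible_elt p -> prime_elt p.
Proof.
move=> ip; have [p0 nup Hp] := ip; have [_ pr] := factA.
have [/size1_polyC ep|sp] := leqP (size p) 1.
  by rewrite ep; apply/prime_polyC/pr/irreducible_polyC; rewrite -ep.
have prim : primitive_poly p.
  move=> c [c0 nuc _] [x e]; have [] := Hp _ _ e.
    by rewrite polyC_unit (negbTE nuc).
  rewrite poly_unitE => /andP[/eqP sx _]; move: sp.
  by rewrite e size_Cmul // sx.
move=> f g pfg.
have [h [a [u [v [h0 ph a0 [[x ex] hf] e]]]]] := bezout_content f p0.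
have [uh|ux] := Hp _ _ ex.
  right; apply: (primitive_cancel prim p0 a0).
  suff : divides p (a%:P * h * g).
    case=> y ey; exists (y * h^-1); rewrite mulrA -ey.
    by rewrite [_ * h * g]mulrAC mulrK.
  by rewrite e mulrDl -mulrA [p * g]mulrC mulrA -[v * f * g]mulrA;
    apply: dividesD; apply: dividesMl => //; exact: divides_refl.
left; apply: divides_trans hf; rewrite ex; exists x^-1.
by rewrite mulrK.
Qed.

Lemma factorial_poly : factorial_ring {poly A}.
Proof.
split; last exact: irreducible_prime_poly.
have [[N dN] _] := factA.
(* Both summands are additive, and they vanish together only on units. *)
exists (fun p => N (lead_coef p) + (size p).-1)%N; split=> [p q p0 q0|p p0].
  rewrite lead_coefM dN.1 ?lead_coef_eq0 // size_mul //.
  rewrite -size_poly_gt0 in p0; rewrite -size_poly_gt0 in q0.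
  move: p0 q0; case: (size p) (size q) => [//|m] [//|k] _ _.
  by rewrite addSn addnS /= addnACA.
move=> /eqP; rewrite addn_eq0 => /andP[/eqP NO /eqP s0].
have s1 : (size p <= 1)%N by case: (size p) s0 => // k /= ->.
move: NO p0; rewrite (size1_polyC s1) lead_coefC polyC_unit polyC_eq0.
by move=> NO p0; exact: dN.2.
Qed.

(** Over the fraction field p and q are coprime; clearing denominators in a
    Bezout identity eliminates the variable. *)
Lemma elimination p q : p != 0 -> no_common_irreducible_factor p q ->
  exists a u v, a != 0 /\ a%:P = u * p + v * q.
Proof.
move=> p0 cop; have [h [a [u [v [h0 ph a0 [hp hq] e]]]]] := bezout_content q p0.
have uh : h \is a GRing.unit.
  apply: contrapT => /negP nuh; have [[N dN] _] := factorial_poly.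
  have [d [dd dh]] := exists_irreducible_divisor dN h0 nuh.
  by apply: (cop d dd); split; exact: divides_trans dh _.
exists a, (h^-1 * u), (h^-1 * v); split=> //.
by rewrite -!mulrA -mulrDr -e mulrC mulrK.
Qed.

End PolynomialsOverFactorialRing.

Lemma factorial_iso (A B : idomainType) (f : {rmorphism A -> B})
  (g : {rmorphism B -> A}) : cancel f g -> cancel g f ->
  factorial_ring B -> factorial_ring A.
Proof.
move=> fK gK [[N dN] pr].
have f0 a : (f a == 0) = (a == 0).
  by rewrite -(inj_eq (can_inj fK)) rmorph0.
have fu a : (f a \is a GRing.unit) = (a \is a GRing.unit).
  apply/idP/idP; last exact: rmorph_unit.
  by move=> /(rmorph_unit g); rewrite fK.
split.
  exists (N \o f); split => [a b a0 b0|a a0] /=.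
    by rewrite rmorphM dN.1 ?f0.
  by rewrite -fu; apply: dN.2; rewrite f0.
move=> p [p0 nup Hp]; have : prime_elt (f p).
  apply: pr; split; rewrite ?f0 ?fu // => a b e.
  have := Hp (g a) (g b); rewrite -rmorphM -e fK => /(_ erefl).
  by rewrite -!fu !gK.
move=> prp a b [c e]; have [|[x ex]|[x ex]] := prp (f a) (f b).
- by exists (f c); rewrite -rmorphM e rmorphM.
- by left; exists (g x); rewrite -[p]fK -rmorphM -ex fK.
- by right; exists (g x); rewrite -[p]fK -rmorphM -ex fK.
Qed.

Lemma factorial_field (A : idomainType) :
  (forall a : A, a != 0 -> a \is a GRing.unit) -> factorial_ring A.
Proof.
move=> H; split; last by move=> p [/H ->].
by exists (fun=> 0%N); split=> // a a0 _; exact: H.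
Qed.

(** * Separating one variable *)

Lemma mpoly_rmorph_ext n (K S : comNzRingType) (f g : {rmorphism mpoly n K -> S}) :
  (forall c, f (mpolyC n c) = g (mpolyC n c)) ->
  (forall i, f (mpolyX K (mnm1 i)) = g (mpolyX K (mnm1 i))) -> f =1 g.
Proof.
move=> fgC fgX p; rewrite (mpolyE p) !rmorph_sum; apply: eq_bigr => m _.
rewrite -mul_mpolyC !rmorphM fgC mpolyXE_id !rmorph_prod; congr (_ * _).
by apply: eq_bigr => i _; rewrite !rmorphXn /= fgX.
Qed.

Lemma poly_rmorph_ext (K S : nzRingType) (f g : {rmorphism {poly K} -> S}) :
  (forall c, f c%:P = g c%:P) -> f 'X = g 'X -> f =1 g.
Proof.
move=> fgC fgX p; rewrite -(coefK p) poly_def !rmorph_sum; apply: eq_bigr => i _.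
by rewrite -mul_polyC !rmorphM !rmorphXn /= fgC fgX.
Qed.

Section SeparateVariable.
Variables (K : idomainType) (n : nat) (j : 'I_n.+1).
Implicit Types (p q : mpoly n.+1 K).

(** The isomorphism from the ring in n + 1 variables to the polynomials in z_j
    over the ring in the other n variables; [combine] is its inverse. *)
Definition separate : mpoly n.+1 K -> {poly mpoly n K} :=
  mmap (polyC \o @mpolyC n K)
    (fun i => if unlift j i is Some k then (mpolyX K (mnm1 k))%:P else 'X).

HB.instance Definition _ := GRing.RMorphism.on separate.

Definition lift_var : mpoly n K -> mpoly n.+1 K :=
  mmap (@mpolyC n.+1 K) (fun k => mpolyX K (mnm1 (lift j k))).

HB.instance Definition _ := GRing.RMorphism.on lift_var.

Definition combine : {poly mpoly n K} -> mpoly n.+1 K :=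
  horner_eval (mpolyX K (mnm1 j)) \o map_poly lift_var.

HB.instance Definition _ := GRing.RMorphism.on combine.

Lemma separateC c : separate (mpolyC n.+1 c) = (mpolyC n c)%:P.
Proof. by rewrite /separate mmapC. Qed.

Lemma separateX i : separate (mpolyX K (mnm1 i)) =
  if unlift j i is Some k then (mpolyX K (mnm1 k))%:P else 'X.
Proof. by rewrite /separate mmapX mmap1U. Qed.

Lemma combineC c : combine c%:P = lift_var c.
Proof. by rewrite /combine /= /horner_eval map_polyC hornerC. Qed.

Lemma combineX : combine 'X = mpolyX K (mnm1 j).
Proof. by rewrite /combine /= /horner_eval map_polyX hornerX. Qed.

Lemma separateK : cancel separate combine.
Proof.
apply: (@mpoly_rmorph_ext _ _ _ (combine \o separate) idfun) => [c|i] /=.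
  by rewrite separateC combineC /lift_var mmapC.
rewrite separateX; case: unliftP => [k ->|->]; last exact: combineX.
by rewrite combineC /lift_var mmapX mmap1U.
Qed.

Lemma separate_neq0 p : p != 0 -> separate p != 0.
Proof. by apply: contra => /eqP e; rewrite -(separateK p) e rmorph0. Qed.

Lemma combineK : cancel combine separate.
Proof.
apply: (@poly_rmorph_ext _ _ (separate \o combine) idfun) => [|/=].
  apply: (@mpoly_rmorph_ext _ _ _ (separate \o combine \o polyC) polyC) => [c|i] /=.
    by rewrite combineC /lift_var mmapC separateC.
  by rewrite combineC /lift_var mmapX mmap1U separateX liftK.
by rewrite combineX separateX unlift_none.
Qed.

Lemma meval_separate (z : 'I_n.+1 -> K) p :
  meval z p = (map_poly (meval (z \o lift j)) (separate p)).[z j].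
Proof.
apply: (@mpoly_rmorph_ext _ _ _ (meval z)
  (horner_eval (z j) \o map_poly (meval (z \o lift j)) \o separate)) => [c|i] /=.
  by rewrite separateC /horner_eval map_polyC hornerC /= !mevalC.
rewrite separateX mevalXU /horner_eval; case: unliftP => [k ->|->].
  by rewrite map_polyC hornerC /= mevalXU.
by rewrite map_polyX hornerX.
Qed.

Definition drop_var (m : multinom n.+1) : multinom n :=
  Multinom [tuple m (lift j k) | k < n].

Lemma separateXm m :
  separate (mpolyX K m) = (mpolyX K (drop_var m))%:P * 'X^(m j).
Proof.
rewrite mpolyXE_id rmorph_prod (bigD1_ord j) //= rmorphXn /= separateX.
rewrite unlift_none mulrC; congr (_ * _).
rewrite mpolyXE_id rmorph_prod; apply: eq_bigr => k _.
by rewrite !rmorphXn /= separateX liftK multinomE tnth_mktuple.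
Qed.

Lemma coef_separate p k m :
  mcoeff m (separate p)`_k =
  \sum_(l <- msupp p | (l j == k) && (drop_var l == m)) mcoeff l p.
Proof.
rewrite {1}(mpolyE p) rmorph_sum coef_sum raddf_sum [RHS]big_mkcond /=.
apply: eq_bigr => l _.
rewrite -mul_mpolyC rmorphM /= separateC separateXm mulrA -polyCM coefCM coefXn.
rewrite -[k == l j]eq_sym; have [e|_] := eqVneq (l j) k; last by rewrite mulr0 mcoeff0.
by rewrite mulr1 mul_mpolyC mcoeffZ mcoeffX; case: eqP; rewrite ?mulr1 ?mulr0.
Qed.

Lemma drop_var_inj (l m : multinom n.+1) :
  l j = m j -> drop_var l = drop_var m -> l = m.
Proof.
move=> ej /mnmP ed; apply/mnmP => i; case: (unliftP j i) => [k|] -> //.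
by have := ed k; rewrite !multinomE !tnth_mktuple.
Qed.

(** As morphisms of integral domains, to which the divisibility lemmas apply. *)
Definition separate_morph : {rmorphism
  (mpoly n.+1 K : idomainType) -> ({poly mpoly n K} : idomainType)} := separate.
Definition combine_morph : {rmorphism
  ({poly mpoly n K} : idomainType) -> (mpoly n.+1 K : idomainType)} := combine.

Lemma separate_morphK : cancel separate_morph combine_morph.
Proof. exact: separateK. Qed.

Lemma combine_morphK : cancel combine_morph separate_morph.
Proof. exact: combineK. Qed.

End SeparateVariable.

Lemma iso_no_common (A B : idomainType) (f : {rmorphism A -> B})
  (g : {rmorphism B -> A}) p q : cancel f g -> cancel g f ->
  no_common_irreducible_factor p q ->
  no_common_irreducible_factor (f p) (f q).
Proof.
move=> fK gK cop d [d0 nud Hd] [[x ex] [y ey]].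
have gu a : (g a \is a GRing.unit) = (a \is a GRing.unit).
  apply/idP/idP; last exact: rmorph_unit.
  by move=> /(rmorph_unit f); rewrite gK.
apply: (cop (g d)); last first.
  by split; [exists (g x)|exists (g y)]; rewrite -rmorphM -?ex -?ey fK.
split; rewrite ?gu //.
  by apply: contra d0 => /eqP gd0; rewrite -[d]gK gd0 rmorph0.
move=> a b e; have := Hd (f a) (f b); rewrite -rmorphM -e gK => /(_ erefl).
by rewrite -!gu !fK.
Qed.

Section PolynomialRing.
Variable K : idomainType.
Hypothesis fieldK : forall c : K, c != 0 -> c \is a GRing.unit.

Lemma mpoly_const0 (p : mpoly 0 K) : p = mpolyC 0 (mcoeff (@mnm0 0) p).
Proof.
apply/mpolyP => m; rewrite mcoeffC.
have -> : m = @mnm0 0 by apply/mnmP => -[].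
by rewrite eqxx mulr1.
Qed.

Lemma mpolyC_unit n c : c != 0 -> mpolyC n c \is a @GRing.unit (mpoly n K).
Proof. by move=> /fieldK; exact: rmorph_unit. Qed.

Lemma unit_mpolyC n (p : mpoly n K) :
  p \is a GRing.unit -> exists2 c, c != 0 & p = mpolyC n c.
Proof.
move=> /mulVr/mpoly_intro_unit/andP[/eqP e u].
by exists (mcoeff mnm0 p) => //; apply: contraTneq u => ->; rewrite unitr0.
Qed.

Lemma factorial_mpoly n : factorial_ring (mpoly n K).
Proof.
elim: n => [|n IH].
  apply: factorial_field => p; rewrite (mpoly_const0 p) mpolyC_eq0.
  exact: mpolyC_unit.
exact: (factorial_iso (@separate_morphK K n ord0)
  (@combine_morphK K n ord0) (factorial_poly IH)).
Qed.

Lemma additive_degree_msize n :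
  additive_degree (fun p : mpoly n K => (msize p).-1).
Proof.
split=> [p q p0 q0|p p0].
  rewrite msizeM //; move: p0 q0; rewrite -!msize_poly_eq0.
  by case: (msize p) (msize q) => [//|k] [//|l] _ _; rewrite addSn addnS.
move=> s0; have s1 : (msize p <= 1)%N by case: (msize p) s0 => // k /= ->.
move: p0; rewrite (msize1_polyC s1) mpolyC_eq0; exact: mpolyC_unit.
Qed.

Lemma eliminate_variable n (j : 'I_n) (p q : mpoly n K) : p != 0 ->
  no_common_irreducible_factor p q ->
  exists r u v, [/\ r != 0, r = u * p + v * q &
    forall z z' : 'I_n -> K, (forall k, k != j -> z k = z' k) ->
      meval z r = meval z' r].
Proof.
case: n j p q => [[]//|n] j p q p0 cop.
have sp0 := separate_neq0 j p0.
have [c [u [v [c0 e]]]] := elimination (factorial_mpoly n) sp0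
  (iso_no_common (@separate_morphK K n j) (@combine_morphK K n j) cop).
pose co := @combine_morph K n j; exists (co c%:P), (co u), (co v); split.
- apply: contra c0 => /eqP e0.
  by rewrite -polyC_eq0 -(combineK j c%:P) [combine _ _]e0 rmorph0.
- rewrite e rmorphD; congr (_ + _); rewrite (rmorphM co); congr (_ * _); exact: separate_morphK.
move=> z z' zz'; rewrite !(meval_separate j) combineK !map_polyC !hornerC /=.
by apply: meval_eq => k /=; apply: zz'; rewrite eq_sym neq_lift.
Qed.

End PolynomialRing.

Section Degrees.
Variable R : realType.
Local Notation C := R[i].

Lemma degree_inE n (P : mpoly n.+1 C) j :
  degree_in P j = (size (separate j P)).-1.
Proof.
have [->|P0] := eqVneq P 0.
  by rewrite rmorph0 size_poly0 /degree_in msupp0 big_nil.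
have ub : (size (separate j P) <= (degree_in P j).+1)%N.
  apply/leq_sizeP => k dk; apply/mpolyP => m; rewrite coef_separate mcoeff0.
  rewrite big_seq_cond big_pred0 // => l; apply/negbTE/negP => /and3P[lP /eqP lk _].
  by have := le_nu j lP; rewrite multinomE tnth_mktuple lk leqNgt dk.
apply/anti_leq/andP; split; last first.
  by case: (size _) ub.
apply/bigmax_leqP_seq => m mP _.
have : (separate j P)`_(m j) != 0.
  apply: contraTneq mP => e0; rewrite mcoeff_msupp negbK.
  have := coef_separate j P (m j) (drop_var j m); rewrite e0 mcoeff0 => /esym/eqP.
  rewrite (eq_bigl (fun l => l == m)) => [|l]; last first.
    apply/andP/eqP => [[/eqP h1 /eqP h2]|->]; last by rewrite !eqxx.
    exact: drop_var_inj h2.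
  rewrite -big_filter; case: (boolP (m \in msupp P)) => mP.
    rewrite (eq_filter (a2 := pred1 m)) // filter_pred1_uniq ?msupp_uniq //.
    by rewrite big_seq1.
  by rewrite (memN_msupp_eq0 mP) eqxx.
apply: contraNT; rewrite -ltnNge => lt; apply/eqP/nth_default.
exact: leq_trans (leqSpred _) lt.
Qed.

Lemma degree_inM n (P Q : mpoly n C) j : P != 0 -> Q != 0 ->
  degree_in (P * Q) j = (degree_in P j + degree_in Q j)%N.
Proof.
case: n P Q j => [P Q []//|n] P Q j P0 Q0; rewrite !degree_inE rmorphM.
have posD a b : (0 < a -> 0 < b -> (a + b).-1.-1 = a.-1 + b.-1)%N.
  by case: a b => [//|a] [//|b]; rewrite addSn addnS.
by rewrite size_mul ?separate_neq0 // posD // size_poly_gt0 separate_neq0.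
Qed.

Lemma nuM n (P Q : mpoly n C) : P != 0 -> Q != 0 ->
  nu (P * Q) = mnm_add (nu P) (nu Q).
Proof.
move=> P0 Q0; apply/mnmP => j.
by rewrite mnmDE !multinomE !tnth_mktuple degree_inM.
Qed.

Lemma nuE n (P : mpoly n C) j : nu P j = degree_in P j.
Proof. by rewrite multinomE tnth_mktuple. Qed.

Lemma nu0_const n (P : mpoly n C) : nu P = mnm0 ->
  P = mpolyC n (mcoeff (@mnm0 n) P).
Proof.
move=> n0; apply/mpolyP => m; rewrite mcoeffC.
have [->|m0] := eqVneq m (@mnm0 n); first by rewrite mulr1.
rewrite mulr0; apply/eqP; rewrite mcoeff_eq0; apply: contra m0 => mP.
by apply/eqP/mnmP => j; apply/eqP; rewrite mnm0E -leqn0; have := le_nu j mP;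
  rewrite n0 mnm0E.
Qed.

Lemma nu_mpolyC n c : nu (mpolyC n c : mpoly n C) = @mnm0 n.
Proof.
apply/mnmP => j; rewrite nuE mnm0E /degree_in msuppC.
by case: eqP => _; rewrite ?big_nil // big_seq1 mnm0E.
Qed.

Lemma nuX n (m : multinom n) : nu (mpolyX C m) = m.
Proof. by apply/mnmP => j; rewrite nuE /degree_in msuppX big_seq1. Qed.

End Degrees.

(** * Zero sets on the torus are null *)

Section ComplexMeasurable.
Context (R : realType) d (T : measurableType d).
Implicit Types F G : T -> R[i].

Definition complex_measurable F :=
  measurable_fun setT (fun t => complex.Re (F t)) /\
  measurable_fun setT (fun t => complex.Im (F t)).

Lemma complex_measurable_cst c : complex_measurable (fun=> c).
Proof. by split; exact: measurable_cst. Qed.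

Lemma complex_measurableD F G : complex_measurable F -> complex_measurable G ->
  complex_measurable (fun t => F t + G t).
Proof.
move=> [F1 F2] [G1 G2]; split.
  by under eq_fun do rewrite raddfD /=; exact: measurable_funD.
by under eq_fun do rewrite raddfD /=; exact: measurable_funD.
Qed.

Lemma complex_measurableM F G : complex_measurable F -> complex_measurable G ->
  complex_measurable (fun t => F t * G t).
Proof.
move=> [F1 F2] [G1 G2]; split.
  rewrite (_ : (fun t => _) = fun t => complex.Re (F t) * complex.Re (G t) -
      complex.Im (F t) * complex.Im (G t)); last first.
    by apply/funext => t; case: (F t) => a b; case: (G t).
  by apply: measurable_funB; exact: measurable_funM.
rewrite (_ : (fun t => _) = fun t => complex.Re (F t) * complex.Im (G t) +
    complex.Im (F t) * complex.Re (G t)); last first.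
  by apply/funext => t; case: (F t) => a b; case: (G t).
by apply: measurable_funD; exact: measurable_funM.
Qed.

Lemma complex_measurable_sum (I : Type) (s : seq I) (F : I -> T -> R[i]) :
  (forall i, complex_measurable (F i)) ->
  complex_measurable (fun t => \sum_(i <- s) F i t).
Proof.
move=> mF; elim: s => [|i s IH].
  by under eq_fun do rewrite big_nil; exact: complex_measurable_cst.
by under eq_fun do rewrite big_cons; exact: complex_measurableD.
Qed.

Lemma complex_measurable_prod (I : Type) (s : seq I) (F : I -> T -> R[i]) :
  (forall i, complex_measurable (F i)) ->
  complex_measurable (fun t => \prod_(i <- s) F i t).
Proof.
move=> mF; elim: s => [|i s IH].
  by under eq_fun do rewrite big_nil; exact: complex_measurable_cst.
by under eq_fun do rewrite big_cons; exact: complex_measurableM.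
Qed.

Lemma complex_measurableX F k : complex_measurable F ->
  complex_measurable (fun t => F t ^+ k).
Proof.
move=> mF; elim: k => [|k IH].
  by under eq_fun do rewrite expr0; exact: complex_measurable_cst.
by under eq_fun do rewrite exprS; exact: complex_measurableM.
Qed.

Lemma measurable_zero_set F : complex_measurable F ->
  measurable [set t | F t = 0].
Proof.
move=> [F1 F2].
rewrite (_ : [set t | F t = 0] =
   (fun t => complex.Re (F t)) @^-1` [set 0] `&`
   (fun t => complex.Im (F t)) @^-1` [set 0]).
  by apply: measurableI; rewrite -[X in measurable X]setTI; [apply: F1|apply: F2].
apply/seteqP; split=> t /=; first by move=> ->.
by case: (F t) => a b /= [-> ->].
Qed.

End ComplexMeasurable.

Section NullSets.
Variable R : realType.
Local Notation C := R[i].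

Lemma complex_measurable_circle_point :
  complex_measurable (@circle_point R : measurableTypeR R -> C).
Proof.
by split=> /=; apply: continuous_measurable_fun;
  [exact: continuous_cos | exact: continuous_sin].
Qed.

Lemma complex_measurable_peval n (P : mpoly n C) :
  complex_measurable (fun t : n.-tuple (measurableTypeR R) =>
    peval P (torus_point t)).
Proof.
under eq_fun do rewrite /peval mevalE.
apply: complex_measurable_sum => m.
apply: complex_measurableM; first exact: complex_measurable_cst.
apply: complex_measurable_prod => j; apply: complex_measurableX.
under eq_fun do rewrite /torus_point mxE.
have [c s] := complex_measurable_circle_point.
by split; [exact: (measurableT_comp c (measurable_tnth j)) |
           exact: (measurableT_comp s (measurable_tnth j))].
Qed.

(** The cosine determines the angle on [0, pi], and by symmetry on [pi, 2 pi]. *)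
Lemma circle_point_angle (t : R) (c : C) : t \in `[0, 2 * pi] ->
  circle_point t = c ->
  t \in [:: acos (complex.Re c); 2 * pi - acos (complex.Re c)].
Proof.
rewrite in_itv /= => /andP[t0 t2] <- /=; rewrite !inE.
have [tp|pt] := leP t pi; first by rewrite cosK ?eqxx // in_itv /= t0.
rewrite -(cosN t) -(cosD2pi (- t)) -[pi *+ 2]mulr_natl cosK; last first.
  rewrite in_itv /= addrC subr_ge0 t2 /= lerBlDr mulr_natl mulr2n lerD2l.
  exact: ltW.
by rewrite [- t + _]addrC subKr eqxx orbT.
Qed.

Lemma uniform_null_roots (h : {poly C}) : h != 0 ->
  uniform_prob (two_pi_gt0 R) [set t | h.[circle_point t] = 0] = 0%E.
Proof.
move=> h0; rewrite /uniform_prob integral_uniform_pdf.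
set A := [set t | _].
have mA : measurable A.
  apply: measurable_zero_set; under eq_fun do rewrite horner_coef.
  apply: complex_measurable_sum => i; apply: complex_measurableM.
    exact: complex_measurable_cst.
  exact/complex_measurableX/complex_measurable_circle_point.
apply: null_set_integral.
- exact: measurableI.
- by apply/measurable_funTS/measurableT_comp => //; exact: measurable_uniform_pdf.
have [r er] := closed_field_poly_normal h.
apply: countable_lebesgue_measure0; apply: finite_set_countable.
pose s := flatten [seq [:: acos (complex.Re c); 2 * pi - acos (complex.Re c)]
  | c : C <- r].
apply: (@sub_finite_set _ _ [set` s]); last exact: finite_seq.
move=> t [At t02] /=.
have rt : circle_point t \in r.
  have : root h (circle_point t) by apply/eqP.
  by rewrite er rootZ ?lead_coef_eq0 // root_prod_XsubC.
apply/flattenP; exists [:: acos (complex.Re (circle_point t));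
    2 * pi - acos (complex.Re (circle_point t))].
  by apply/mapP; exists (circle_point t).
exact: circle_point_angle t02 erefl.
Qed.

(** Fubini in the first angle: outside the null set of angles at which one
    coefficient h of P, seen as a polynomial in the other variables, vanishes,
    the slice of P is a nonzero polynomial in the other variables. *)
Lemma torus_null n (P : mpoly n C) : P != 0 ->
  torus_prob R n [set t | peval P (torus_point t) = 0] = 0%E.
Proof.
elim: n P => [|n IH] P P0.
  rewrite /= /dirac indicE memNset //= /peval => e.
  move: P0 e; rewrite (mpoly_const0 P) mpolyC_eq0 mevalC => /negP + e.
  by rewrite e eqxx.
set S := separate ord0 P.
have S0 : S != 0 by exact: separate_neq0.
have [m mS] : exists m, mcoeff m (lead_coef S) != 0.
  apply: contrapT => /forallNP H; move: S0; rewrite -lead_coef_eq0 => /eqP; apply.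
  by apply/mpolyP => m; rewrite mcoeff0; apply/eqP; apply: contrapT => /negP /H.
pose h := \poly_(k < size S) mcoeff m S`_k.
have h0 : h != 0.
  apply/eqP => /(congr1 (fun q : {poly C} => q`_(size S).-1)).
  rewrite coef_poly coef0 -polySpred ?S0 // leqnn.
  by move=> e; move: mS; rewrite lead_coefE e eqxx.
have hS c : mcoeff m S.[mpolyC n c] = h.[c].
  rewrite horner_coef (horner_coef_wide _ (size_poly _ _)) raddf_sum.
  apply: eq_bigr => k _; rewrite coef_poly ltn_ord.
  by rewrite -rmorphXn /= mulrC mcoeffCM mulrC.
set Z := [set t | _].
have mZ : measurable Z.
  exact/measurable_zero_set/complex_measurable_peval.
rewrite /= /distribution /pushforward /= /product_measure1.
set Z' := (@cons_angle R n) @^-1` Z.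
have mZ' : measurable Z'.
  by rewrite -[Z']setTI; exact: measurable_cons_angle.
set N := [set t : measurableTypeR R | h.[circle_point t] = 0].
have mN : measurable N.
  apply: measurable_zero_set; under eq_fun do rewrite horner_coef.
  apply: complex_measurable_sum => i; apply: complex_measurableM.
    exact: complex_measurable_cst.
  exact/complex_measurableX/complex_measurable_circle_point.
rewrite (@ge0_negligible_integral _ _ _ _ setT N) //; first last.
- exact: uniform_null_roots.
- exact: measurable_fun_xsection.
apply: integral0_eq => x [_ Nx] /=.
have -> : xsection Z' x =
    [set t | peval S.[mpolyC n (circle_point x)] (torus_point t) = 0].
  apply/funext => t; rewrite /xsection /Z' /Z /=.
  rewrite inE /=; congr (_ = 0); rewrite /peval (meval_separate ord0).
  rewrite -(horner_map (meval (torus_point t ord0))) /= mevalC.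
  rewrite {2}/torus_point mxE (tnth_nth x) /=; congr (_.[_]).
  apply: eq_map_poly => p; apply: meval_eq => k /=.
  by rewrite !mxE !(tnth_nth x).
apply: IH; apply: contra_notN Nx => /eqP e.
by rewrite /N /= -hS e mcoeff0.
Qed.

End NullSets.

(** * Reflection *)

Section Reflection.
Variables (R : realType) (n : nat).
Local Notation C := R[i].
Implicit Types (P Q : mpoly n C) (z w : 'rV[C]_n).

Lemma pevalD P Q z : peval (P + Q) z = peval P z + peval Q z.
Proof. exact: mevalD. Qed.
Lemma pevalB P Q z : peval (P - Q) z = peval P z - peval Q z.
Proof. exact: mevalB. Qed.
Lemma pevalM P Q z : peval (P * Q) z = peval P z * peval Q z.
Proof. exact: mevalM. Qed.
Lemma pevalZ c P z : peval (c *: P) z = c * peval P z.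
Proof. exact: mevalZ. Qed.
Lemma pevalC c z : peval (mpolyC n c) z = c.
Proof. exact: mevalC. Qed.
Lemma pevalX (m : multinom n) z :
  peval (mpolyX C m) z = \prod_j z ord0 j ^+ m j.
Proof. exact: mevalX. Qed.

Lemma peval_sum (I : Type) (s : seq I) (F : I -> mpoly n C) z :
  peval (\sum_(i <- s) F i) z = \sum_(i <- s) peval (F i) z.
Proof. exact: (raddf_sum (meval (z ord0))). Qed.

Lemma peval0 P : peval P 0 = mcoeff (@mnm0 n) P.
Proof.
apply: (@mpoly_rmorph_ext _ _ _ (meval ((0 : 'rV[C]_n) ord0)) (mcoeff (@mnm0 n))).
  by move=> c /=; rewrite mevalC mcoeffC eqxx mulr1.
move=> j /=; rewrite mevalXU mxE mcoeffX; case: eqP => // /mnmP/(_ j).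
by rewrite mnm1E mnm0E eqxx.
Qed.

(** The torus has positive measure and the zero set of a nonzero polynomial is
    null. *)
Lemma ae_torus_eq0 P :
  {ae torus_prob R n, forall t, peval P (torus_point t) = 0} -> P = 0.
Proof.
move=> [A [mA A0 AP]]; apply/eqP; apply: contrapT => /negP P0.
have := @probability_setT _ _ _ (torus_prob R n) => /eqP; apply/negP.
rewrite -(setUv [set t | peval P (torus_point t) = 0]).
rewrite lt_eqF //; apply: le_lt_trans (_ : (0 < 1)%E); last exact: lte01.
have mZ := measurable_zero_set (complex_measurable_peval P).
apply: (@le_trans _ _ (torus_prob R n ([set t | peval P (torus_point t) = 0] `|` A))).
  apply: le_measure; rewrite ?inE.
  - by apply: measurableU => //; exact: measurableC.
  - exact: measurableU.
  - by apply: setUS => t /=; exact: AP.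
apply: le_trans (measureU2 _ mZ mA) _.
by rewrite [X in (X + _)%E](torus_null P0) [X in (_ + X)%E]A0 adde0.
Qed.

Lemma norm_circle_point (t : R) : `|circle_point t| = 1.
Proof. by rewrite normc_def /= cos2Dsin2 sqrtr1. Qed.

Lemma torus_ext P Q :
  (forall w, (forall j, `|w ord0 j| = 1) -> peval P w = peval Q w) -> P = Q.
Proof.
move=> H; apply/eqP; rewrite -subr_eq0; apply/eqP/ae_torus_eq0/aeW => t /=.
by rewrite pevalB H ?subrr // => j; rewrite mxE norm_circle_point.
Qed.

Lemma peval_conj P z :
  peval (conj_poly P) (\row_j Num.conj (z ord0 j)) = Num.conj (peval P z).
Proof.
rewrite /peval /conj_poly !mevalE rmorph_sum.
have sP : perm_eq (msupp (map_mpoly Num.conj P)) (msupp P).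
  by apply: msupp_map_mpoly; exact: fmorph_inj.
rewrite (perm_big _ sP) /=; apply: eq_bigr => m _.
rewrite mcoeff_map_mpoly rmorphM rmorph_prod; congr (_ * _).
by apply: eq_bigr => j _; rewrite mxE rmorphXn.
Qed.

Lemma reflection_torus P w : (forall j, `|w ord0 j| = 1) ->
  peval (reflection P) w = peval (mpolyX C (nu P)) w * Num.conj (peval P w).
Proof.
move=> w1; rewrite reflectionE => [|j]; last by rewrite -normr_eq0 w1 oner_eq0.
rewrite pevalX -peval_conj; congr (_ * peval _ _); apply/rowP => j; rewrite !mxE.
by rewrite invC_norm w1 expr1n invr1 mul1r.
Qed.

Lemma monomial_torus (m : multinom n) w : (forall j, `|w ord0 j| = 1) ->
  peval (mpolyX C m) w * Num.conj (peval (mpolyX C m) w) = 1.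
Proof.
move=> w1; rewrite -normCK pevalX normr_prod big1 ?expr1n // => j _.
by rewrite normrX w1 expr1n.
Qed.

Lemma mpolyX_neq0 (m : multinom n) : mpolyX C m != 0.
Proof.
apply/eqP => /(congr1 (mcoeff m)) /eqP.
by rewrite mcoeffX eqxx mcoeff0 oner_eq0.
Qed.

Lemma reflection0 : reflection (0 : mpoly n C) = 0.
Proof. by rewrite /reflection msupp0 big_nil. Qed.

Lemma reflectionM P Q : reflection (P * Q) = reflection P * reflection Q.
Proof.
have [->|P0] := eqVneq P 0; first by rewrite mul0r reflection0 mul0r.
have [->|Q0] := eqVneq Q 0; first by rewrite mulr0 reflection0 mulr0.
apply: torus_ext => w w1; rewrite pevalM !reflection_torus // nuM // pevalM.
by rewrite mpolyXD pevalM rmorphM mulrACA.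
Qed.

Lemma reflectionC (c : C) : reflection (mpolyC n c) = mpolyC n (Num.conj c).
Proof.
apply: torus_ext => w w1; rewrite reflection_torus // nu_mpolyC !pevalC.
by rewrite mpolyX0 /peval meval1 mul1r.
Qed.

(** The reflection of a reflection, exact up to the monomial factor that
    reflections lose. *)
Lemma reflectionK_monomial P :
  mpolyX C (nu P) * reflection (reflection P) = mpolyX C (nu (reflection P)) * P.
Proof.
apply: torus_ext => w w1; rewrite !pevalM !reflection_torus // rmorphM.
rewrite /= conjCK mulrCA; congr (_ * _).
by rewrite mulrA monomial_torus // mul1r.
Qed.

Lemma reflection_neq0 P : P != 0 -> reflection P != 0.
Proof.
move=> P0; apply/eqP => e; have /eqP := reflectionK_monomial P.
by rewrite e reflection0 mulr0 eq_sym mulf_eq0 (negbTE P0) (negbTE (mpolyX_neq0 _)).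
Qed.

Lemma nu_reflection_le P j : (nu (reflection P) j <= nu P j)%N.
Proof.
rewrite nuE; apply/bigmax_leqP_seq => m mP _.
have : m \in flatten [seq [:: mnm_sub (nu P) l] | l <- msupp P].
  apply/negPn; apply: contraL mP => nm; rewrite -mcoeff_eq0 /reflection raddf_sum.
  apply/eqP; rewrite big_seq big1 // => l lP; rewrite /= mcoeffZ mcoeffX.
  case: eqP => [e|_]; last by rewrite mulr0.
  case/negP: nm; apply/flattenP; exists [:: mnm_sub (nu P) l].
    by apply/mapP; exists l.
  by rewrite e inE.
move=> /flattenP[s /mapP[l _ ->]]; rewrite inE => /eqP ->.
by rewrite mnmBE leq_subr.
Qed.

(** Compare, in [reflectionK_monomial], the monomial that the constant term of P
    contributes on the right. *)
Lemma nu_reflection P : mcoeff (@mnm0 n) P != 0 -> nu (reflection P) = nu P.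
Proof.
move=> P0; apply/mnmP => j; apply/anti_leq; rewrite nu_reflection_le /=.
have : nu (reflection P) \in msupp (mpolyX C (nu (reflection P)) * P).
  rewrite mulrC (perm_mem (msuppMX _ _)); apply/mapP; exists (@mnm0 n).
    by rewrite mcoeff_msupp.
  by apply/mnmP => k; rewrite mnmDE mnm0E addn0.
rewrite -reflectionK_monomial mulrC (perm_mem (msuppMX _ _)) => /mapP[l _ ->].
by rewrite mnmDE leq_addr.
Qed.

Lemma reflectionK P : mcoeff (@mnm0 n) P != 0 -> reflection (reflection P) = P.
Proof.
move=> P0; have := reflectionK_monomial P; rewrite nu_reflection //.
exact/mulfI/mpolyX_neq0.
Qed.

Lemma norm_reflection_torus P w : (forall j, `|w ord0 j| = 1) ->
  `|peval (reflection P) w| = `|peval P w|.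
Proof.
move=> w1; rewrite reflection_torus // normrM norm_conjC pevalX normr_prod.
by rewrite big1 ?mul1r // => j _; rewrite normrX w1 expr1n.
Qed.

End Reflection.

(** * Zero-free polynomials *)

Section UnivariateZeroFree.
Variable R : realType.
Local Notation C := R[i].
Implicit Types (p q : {poly C}) (x : C).

Lemma zero_free_roots p : p != 0 -> (forall x, `|x| < 1 -> p.[x] != 0) ->
  exists r : seq C, [/\ p = lead_coef p *: \prod_(a <- r) ('X - a%:P),
    size p = (size r).+1 & forall a, a \in r -> 1 <= `|a|].
Proof.
move=> p0 pnz; have [r er] := closed_field_poly_normal p; exists r; split => //.
  by rewrite er size_scale ?lead_coef_eq0 // size_prod_XsubC.
move=> a ar; rewrite real_leNgt ?normr_real //; apply/negP => /pnz; apply/negP.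
by rewrite negbK -/(root p a) er rootZ ?lead_coef_eq0 // root_prod_XsubC.
Qed.

Lemma prod_norm_ge1 (r : seq C) : (forall a, a \in r -> 1 <= `|a|) ->
  1 <= \prod_(a <- r) `|a|.
Proof.
elim: r => [|a r IH] H; rewrite ?big_nil // big_cons.
rewrite -[X in X <= _]mulr1; apply: ler_pM => //.
  by apply: H; rewrite inE eqxx.
by apply: IH => b br; apply: H; rewrite inE br orbT.
Qed.

Lemma norm_zero_free_at0 p r : p = lead_coef p *: \prod_(a <- r) ('X - a%:P) ->
  `|p.[0]| = `|lead_coef p| * \prod_(a <- r) `|a|.
Proof.
move=> e; rewrite {1}e hornerZ normrM horner_prod normr_prod; congr (_ * _).
by apply: eq_bigr => a _; rewrite hornerXsubC sub0r normrN.
Qed.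

(** The constant coefficient is the product of the roots times the leading
    one, and no root lies in the disc. *)
Lemma zero_free_top_coef p d : (size p <= d.+1)%N ->
  (forall x, `|x| < 1 -> p.[x] != 0) -> `|p`_d| <= `|p.[0]|.
Proof.
move=> sp pnz; have [->|p0] := eqVneq p 0; first by rewrite coef0 horner0.
have [lt|le] := ltnP (size p) d.+1.
  by rewrite nth_default // normr0 normr_ge0.
have [r [er sr r1]] := zero_free_roots p0 pnz.
have -> : p`_d = lead_coef p.
  by rewrite lead_coefE (anti_leq (introT andP (conj sp le))).
by rewrite (norm_zero_free_at0 er) ler_peMr // prod_norm_ge1.
Qed.

(** A Harnack inequality: each root a has modulus at least 1, so that
    |x - a| <= (1 + |x|) |a|. *)
Lemma harnack p d x : (size p <= d.+1)%N ->
  (forall y, `|y| < 1 -> p.[y] != 0) ->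
  `|p.[x]| <= (1 + `|x|) ^+ d * `|p.[0]|.
Proof.
move=> sp pnz; have [->|p0] := eqVneq p 0.
  by rewrite !horner0 normr0 mulr0.
have [r [er sr r1]] := zero_free_roots p0 pnz.
rewrite (norm_zero_free_at0 er) {1}er hornerZ normrM mulrCA.
rewrite ler_wpM2l // horner_prod normr_prod.
have x1 : 1 <= 1 + `|x| by rewrite lerDl.
apply: (@le_trans _ _ ((1 + `|x|) ^+ size r * \prod_(a <- r) `|a|)).
  elim: r r1 {er sr} => [|a r IH] r1; first by rewrite !big_nil mulr1.
  rewrite !big_cons exprS mulrACA; apply: ler_pM => //.
  - by apply: prodr_ge0.
  - rewrite hornerXsubC; apply: le_trans (ler_normB _ _) _.
    rewrite mulrDl mul1r addrC lerD2l ler_peMr //.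
    by apply: r1; rewrite inE eqxx.
  - by apply: IH => b br; apply: r1; rewrite inE br orbT.
rewrite ler_wpM2r ?prodr_ge0 // ler_weXn2l //.
by move: sp; rewrite sr ltnS.
Qed.

(** Unlike a leading coefficient, c may vanish; this makes the notion stable
    under sums. *)
Definition top_coef (d : nat) (c : C) p := (size p <= d.+1)%N /\ p`_d = c.

Lemma top_coefC c : top_coef 0 c c%:P.
Proof. by split; rewrite ?coefC // size_polyC leq_b1. Qed.

Lemma top_coefM d e a b p q : top_coef d a p -> top_coef e b q ->
  top_coef (d + e) (a * b) (p * q).
Proof.
move=> [sp pa] [sq qb]; split.
  apply: leq_trans (size_polyMleq _ _) _.
  by rewrite -subn1 leq_subLR add1n -addSn -addnS leq_add.
have lt : (d < (d + e).+1)%N by rewrite ltnS leq_addr.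
rewrite coefM (bigD1 (Ordinal lt)) //= addKn pa qb big1 ?addr0 // => k.
rewrite -val_eqE /= neq_ltn => /orP[kd|dk].
  rewrite [q`__]nth_default ?mulr0 //; apply: leq_trans sq _.
  by rewrite ltn_subRL ltn_add2r.
by rewrite nth_default ?mul0r //; exact: leq_trans sp _.
Qed.

Lemma top_coefX d a p k : top_coef d a p -> top_coef (d * k) (a ^+ k) (p ^+ k).
Proof.
move=> H; elim: k => [|k IH]; first by rewrite muln0 !expr0; exact: top_coefC.
by rewrite mulnS !exprS; exact: top_coefM.
Qed.

Lemma top_coef_prod (I : Type) (s : seq I) (d : I -> nat) a (p : I -> {poly C}) :
  (forall i, top_coef (d i) (a i) (p i)) ->
  top_coef (\sum_(i <- s) d i) (\prod_(i <- s) a i) (\prod_(i <- s) p i).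
Proof.
move=> H; elim: s => [|i s IH]; first by rewrite !big_nil; exact: top_coefC.
by rewrite !big_cons; exact: top_coefM.
Qed.

Lemma top_coef_sum (I : eqType) (s : seq I) d a (p : I -> {poly C}) :
  (forall i, i \in s -> top_coef d (a i) (p i)) ->
  top_coef d (\sum_(i <- s) a i) (\sum_(i <- s) p i).
Proof.
elim: s => [|i s IH] H; first by rewrite !big_nil; split; rewrite ?size_poly0 ?coef0.
have [sp pa] := H i (mem_head _ _).
have [ss sa] := IH (fun j js => H j (mem_behead (s := i :: s) js)).
rewrite !big_cons; split; last by rewrite coefD pa sa.
by apply: leq_trans (size_polyD _ _) _; rewrite geq_max sp.
Qed.

Lemma top_coef_linear a b : top_coef 1 b (a%:P + b *: 'X).
Proof.
split; last by rewrite coefD coefC coefZ coefX mulr1 add0r.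
apply: leq_trans (size_polyD _ _) _; rewrite geq_max.
rewrite (leq_trans (size_polyC_leq1 _)) //.
by rewrite (leq_trans (size_scale_leq _ _)) // size_polyX.
Qed.

End UnivariateZeroFree.

Section PolydiscZeroFree.
Variables (R : realType) (n : nat).
Local Notation C := R[i].
Implicit Types (P Q : mpoly n C) (z w : 'rV[C]_n).

Lemma polydisc0 : @polydisc R n 0.
Proof. by move=> j; rewrite mxE normr0. Qed.

Lemma zero_freeP P : zero_free_on_polydisc P <->
  forall z, polydisc z -> peval P z != 0.
Proof.
split=> [e z Dz|H]; first by apply/eqP => Pz; rewrite -[False]/(set0 z) -e.
by apply/seteqP; split => z //= [Pz /H]; rewrite [peval P z]Pz eqxx.
Qed.

Lemma zero_free_coef0 P : zero_free_on_polydisc P -> mcoeff (@mnm0 n) P != 0.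
Proof. by move=> /zero_freeP/(_ _ polydisc0); rewrite peval0. Qed.

(** The restriction of P to the complex line through z in the direction w. *)
Definition line P z w : {poly C} :=
  \sum_(m <- msupp P) mcoeff m P *:
    \prod_j ((z ord0 j)%:P + w ord0 j *: 'X) ^+ m j.

Lemma horner_line P z w x : (line P z w).[x] = peval P (z + x *: w).
Proof.
rewrite /line /peval mevalE horner_sum; apply: eq_bigr => m _.
rewrite hornerZ horner_prod; congr (_ * _); apply: eq_bigr => j _.
by rewrite horner_exp hornerD hornerC hornerZ hornerX !mxE mulrC.
Qed.

Lemma size_line P z w : (size (line P z w) <= (msize P).+1)%N.
Proof.
apply: leq_trans (size_sum _ _ _) _; rewrite big_seq.
apply/bigmax_leqP_seq => m mP _; apply: leq_trans (size_scale_leq _ _) _.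
have [+ _] := @top_coef_prod R _ (index_enum 'I_n) _ _ _
  (fun j => top_coefX (m j) (top_coef_linear (z ord0 j) (w ord0 j))).
move=> /leq_trans; apply; rewrite ltnS.
under eq_bigr do rewrite mul1n.
by rewrite -mdegE ltnW // msize_mdeg_lt.
Qed.

Lemma harnack_line P z w x :
  (forall y, `|y| < 1 -> peval P (z + y *: w) != 0) ->
  `|peval P (z + x *: w)| <= (1 + `|x|) ^+ msize P * `|peval P z|.
Proof.
move=> H; have := @harnack R (line P z w) (msize P) x (size_line P z w).
rewrite !horner_line scale0r addr0; apply=> y y1.
by rewrite horner_line; exact: H.
Qed.

Lemma moebius_denom_neq0 (a x : C) : `|a| < 1 -> `|x| < 1 ->
  1 + Num.conj a * x != 0.
Proof.
move=> a1 x1; apply/eqP => e.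
have : `|Num.conj a * x| < 1.
  rewrite normrM norm_conjC -[1]mulr1; exact: ltr_pM.
by rewrite -(addKr 1 (_ * x)) e addr0 normrN1 ltxx.
Qed.

Lemma moebius_lt1 (a x : C) : `|a| < 1 -> `|x| < 1 ->
  `|(a + x) / (1 + Num.conj a * x)| < 1.
Proof.
move=> a1 x1; have d0 := moebius_denom_neq0 a1 x1.
rewrite normrM normfV ltr_pdivrMr ?normr_gt0 // mul1r.
rewrite -(@ltr_pXn2r _ 2) ?nnegrE // !normCK -subr_gt0.
rewrite !rmorphD !rmorphM /= rmorph1 conjCK.
have -> : (1 + Num.conj a * x) * (1 + a * Num.conj x) -
    (a + x) * (Num.conj a + Num.conj x) =
    (1 - a * Num.conj a) * (1 - x * Num.conj x) by ring.
rewrite -!normCK mulr_gt0 // subr_gt0 -[1](expr1n _ 2).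
  by rewrite ltr_pXn2r ?nnegrE.
by rewrite ltr_pXn2r ?nnegrE.
Qed.

(** Composing P with the disc automorphisms x |-> (x + z_j) / (1 + conj z_j x)
    and clearing denominators gives a zero-free polynomial in x, whose constant
    coefficient is P(z) and whose top coefficient is the conjugate of the
    reflection of P at z. *)
Lemma norm_reflection_le P z : zero_free_on_polydisc P -> polydisc z ->
  `|peval (reflection P) z| <= `|peval P z|.
Proof.
move=> /zero_freeP Pnz Dz.
pose F (m : multinom n) j := ((z ord0 j)%:P + 1 *: 'X) ^+ m j *
  (1%:P + Num.conj (z ord0 j) *: 'X) ^+ (nu P j - m j).
pose p := \sum_(m <- msupp P) (mcoeff m P)%:P * \prod_j F m j.
pose d := (\sum_j nu P j)%N.
have top : top_coef d (Num.conj (peval (reflection P) z)) p.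
  rewrite /reflection peval_sum rmorph_sum.
  rewrite /p; apply: top_coef_sum => m mP.
  rewrite pevalZ pevalX mcoeff_map_mpoly rmorphM /= conjCK rmorph_prod.
  rewrite -[d]add0n; apply: top_coefM; first exact: top_coefC.
  have := @top_coef_prod R _ (index_enum 'I_n) (fun j => nu P j)
    (fun j => Num.conj (z ord0 j ^+ mnm_sub (nu P) m j)) (F m).
  apply=> j; rewrite mnmBE rmorphXn -[X in top_coef _ X _]mul1r.
  rewrite -{1}(subnKC (le_nu j mP)) -[X in top_coef _ (X * _) _](expr1n _ (m j)).
  rewrite -[X in top_coef (X + _)]mul1n -[X in top_coef (_ + X)]mul1n.
  by apply: top_coefM; apply: top_coefX; exact: top_coef_linear.
have pE x : `|x| < 1 -> p.[x] = \prod_j (1 + Num.conj (z ord0 j) * x) ^+ nu P j *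
    peval P (\row_j ((z ord0 j + x) / (1 + Num.conj (z ord0 j) * x))).
  move=> x1; rewrite /p /peval mevalE horner_sum mulr_sumr.
  rewrite big_seq [RHS]big_seq; apply: eq_bigr => m mP.
  rewrite hornerM hornerC mulrCA horner_prod -big_split /=; congr (_ * _).
  apply: eq_bigr => j _; rewrite hornerM !horner_exp !hornerE mxE.
  have d0 := moebius_denom_neq0 (Dz j) x1.
  rewrite -{2}(subnK (le_nu j mP)) exprD -mulrA expr_div_n mulrC; congr (_ * _).
  by rewrite mulrC divfK // expf_neq0.
have -> : peval P z = p.[0].
  rewrite pE ?normr0 // big1 => [|j _]; last by rewrite mulr0 addr0 expr1n.
  rewrite mul1r; congr peval; apply/rowP => j.
  by rewrite mxE mulr0 !addr0 divr1.
rewrite -(norm_conjC (peval (reflection P) z)) -top.2.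
apply: zero_free_top_coef; first exact: top.1.
move=> x x1; rewrite pE // mulf_neq0 //; last first.
  by apply: Pnz => j; rewrite mxE; exact: moebius_lt1.
by apply/prodf_neq0 => j _; rewrite expf_neq0 // moebius_denom_neq0.
Qed.

End PolydiscZeroFree.

(** * Polynomials as functions on the polydisc *)

Section Topology.
Variables (R : realType) (n : nat).
Local Notation C := R[i].
Implicit Types (P Q : mpoly n C) (z w : 'rV[C]_n) (f g : 'rV[C]_n -> C).

Lemma peval_differentiable P z : differentiable (peval P) z.
Proof.
rewrite (_ : peval P = \sum_(m <- msupp P) (fun z : 'rV[C]_n =>
    mcoeff m P * \prod_j z ord0 j ^+ m j)); last first.
  by apply/funext => w; rewrite fct_sumE /peval mevalE.
elim/big_ind: _ => [|f g|m _]; first exact: differentiable_cst.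
  exact: differentiableD.
apply: differentiableM; first exact: differentiable_cst.
elim: (index_enum _) => [|j s IH].
  by under eq_fun do rewrite big_nil; exact: differentiable_cst.
under eq_fun do rewrite big_cons; apply: differentiableM => //.
elim: (m j) => [|k IHk].
  by under eq_fun do rewrite expr0; exact: differentiable_cst.
under eq_fun do rewrite exprS; apply: differentiableM => //.
exact: differentiable_coord.
Qed.

Lemma peval_continuous P : continuous (peval P).
Proof. by move=> z; exact/differentiable_continuous/peval_differentiable. Qed.

Lemma holomorphic_continuous f z : holomorphic f -> polydisc z ->
  {for z, continuous f}.
Proof. by move=> hf Dz; exact/differentiable_continuous/hf. Qed.

Lemma near_polydisc z : polydisc z -> \forall w \near z, polydisc w.
Proof.
move=> Dz.
apply: (@filter_forall _ _ (fun j => [set w : 'rV[C]_n | `|w ord0 j| < 1])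
  (nbhs z) _) => j.
exact: (cvgr_norm_lt (z ord0 j) (@coord_continuous _ _ _ ord0 j z) 1 (Dz j)).
Qed.

Lemma poly_near0 (h : {poly C}) : (\forall x \near (0 : C), h.[x] = 0) -> h = 0.
Proof.
move=> /nbhs_ballP[e /= e0 H]; apply/eqP; apply: contraT => h0.
pose s := [seq e / k.+2%:R | k <- iota 0 (size h)].
have us : uniq s.
  rewrite map_inj_uniq ?iota_uniq // => k l.
  move=> /(mulfI (lt0r_neq0 e0))/invr_inj/eqP.
  by rewrite eqr_nat => /eqP[].
have := max_poly_roots h0 _ us; rewrite size_map size_iota ltnn; apply.
apply/allP => x /mapP[k _ ->]; apply/eqP/H.
rewrite -ball_normE /= sub0r normrN ger0_norm ?divr_ge0 ?ltW //.
by rewrite ltr_pdivrMr // ltr_pMr // ltr1n.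
Qed.

(** On each complex line through z the restriction of P has infinitely many
    zeros. *)
Lemma peval_near0 P z : (\forall w \near z, peval P w = 0) -> P = 0.
Proof.
move=> H; apply: torus_ext => w _; rewrite [peval 0 w]meval0.
have : line P z (w - z) = 0.
  apply: poly_near0.
  have c1 : x *: (w - z) @[x --> (0 : C)] --> (0 : C) *: (w - z).
    by apply: (@cvgZr_tmp C _ C (nbhs (0 : C)) _ id); exact: cvg_id.
  have c : z + x *: (w - z) @[x --> (0 : C)] --> z + (0 : C) *: (w - z).
    by apply: (@cvgD C _ C (nbhs (0 : C)) _ (fun=> z)); first exact: cvg_cst.
  have g0 : z = z + 0 *: (w - z) by rewrite scale0r addr0.
  rewrite {1}g0 in H; have := c _ H; apply: (@filterS _ (nbhs (0 : C)) _) => x /=.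
  by rewrite horner_line.
move=> /(congr1 (fun h : {poly C} => h.[1])).
by rewrite horner_line horner0 scale1r addrC subrK.
Qed.

Lemma peval_polydisc_inj P Q :
  (forall z, polydisc z -> peval P z = peval Q z) -> P = Q.
Proof.
move=> H; apply/eqP; rewrite -subr_eq0; apply/eqP/(@peval_near0 _ 0).
near=> w; rewrite pevalB H ?subrr //; near: w.
exact/near_polydisc/polydisc0.
Unshelve. all: by end_near. Qed.

(** The complement of a hypersurface is dense. *)
Lemma continuous_eq_off_zeros f g Q z : Q != 0 -> polydisc z ->
  {for z, continuous f} -> {for z, continuous g} ->
  (forall w, polydisc w -> peval Q w != 0 -> f w = g w) -> f z = g z.
Proof.
move=> Q0 Dz cf cg H; apply/eqP; rewrite -subr_eq0; apply/eqP.
apply: contrapT => /eqP fg; move: Q0; apply/negP; rewrite negbK; apply/eqP.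
apply: (@peval_near0 _ z).
have c : f w - g w @[w --> z] --> f z - g z.
  exact: (@cvgB C _ _ (nbhs z) _ f g _ _ cf cg).
have nz : \forall w \near z, f w - g w != 0.
  exact: (cvgr_neq0 (f z - g z) c).
apply: filterS2 (near_polydisc Dz) nz => w Dw.
by apply: contraNeq => Qw; rewrite H ?subrr.
Qed.

(** Two zero-free polynomials of the same modulus are proportional: for t off
    the unit circle P - t Q is zero-free, hence so is its limit as t tends to
    c = P(0)/Q(0), unless it vanishes identically; but it vanishes at 0. *)
Lemma zero_free_same_norm P Q : zero_free_on_polydisc P ->
  zero_free_on_polydisc Q ->
  (forall z, polydisc z -> `|peval P z| = `|peval Q z|) ->
  exists c, P = c *: Q.
Proof.
move=> /zero_freeP P0 /zero_freeP Q0 PQ.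
have D0 := @polydisc0 R n.
have [c Pc] : exists c, peval P 0 = c * peval Q 0.
  by exists (peval P 0 / peval Q 0); rewrite divfK ?Q0.
exists c.
have c1 : `|c| = 1.
  apply: (mulIf (x := `|peval Q 0|)); first by rewrite normr_eq0 Q0.
  by rewrite mul1r -normrM -Pc PQ.
pose H (e : C) := P - ((1 + e) * c) *: Q.
pose N := maxn (msize P) (msize Q).
have sH e : (msize (H e) <= N)%N.
  apply: leq_trans (mmeasureD_le _ _ _) _; rewrite mmeasureN geq_max leq_maxl.
  by rewrite (leq_trans (mmeasureZ_le _ _ _)) // leq_maxr.
have Hnz e z : 0 < e -> polydisc z -> peval (H e) z != 0.
  move=> e0 Dz; rewrite pevalB pevalZ subr_eq0; apply/eqP => /(congr1 Num.norm).
  rewrite PQ // normrM => /eqP; rewrite -{1}[`|peval Q z|]mul1r.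
  rewrite (inj_eq (mulIf _)) ?normr_eq0 ?Q0 // normrM c1 mulr1 => /eqP e1.
  have : `|1 + e| > 1 by rewrite ger0_norm ?ltrDl // addr_ge0 // ltW.
  by rewrite -e1 ltxx.
have H0 e : 0 < e -> `|peval (H e) 0| = e * `|peval Q 0|.
  move=> e0; rewrite pevalB pevalZ mulrDl mul1r mulrDl -Pc.
  by rewrite opprD addrA subrr sub0r normrN !normrM c1 mulr1 gtr0_norm.
apply: peval_polydisc_inj => z Dz; rewrite pevalZ.
apply/eqP; rewrite -subr_eq0 -normr_le0.
have bound e : 0 < e -> `|peval P z - c * peval Q z| <=
    e * (2 ^+ N * `|peval Q 0| + `|peval Q z|).
  move=> e0; have -> : peval P z - c * peval Q z =
      peval (H e) z + e * c * peval Q z.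
    by rewrite pevalB pevalZ mulrDl mul1r mulrDl; ring.
  apply: le_trans (ler_normD _ _) _; rewrite mulrDr lerD //; last first.
    by rewrite !normrM c1 mulr1 gtr0_norm.
  have := @harnack_line R n (H e) 0 z 1.
  rewrite scale1r add0r normr1 H0 // mulrCA => h; apply: le_trans (h _) _.
    move=> y y1; apply: Hnz => // j; rewrite add0r mxE normrM.
    by rewrite -[1]mulr1; apply: ltr_pM.
  rewrite ler_wpM2l ?(ltW e0) // ler_wpM2r // ler_weXn2l //.
  by rewrite -[X in X <= _]addr0 lerD2l.
apply/ler_addgt0Pl => e e0; rewrite addr0.
set K := 2 ^+ N * _ + _ in bound.
have K_ge0 : 0 <= K.
  by rewrite /K; apply: addr_ge0 => //; apply: mulr_ge0 => //; exact: exprn_ge0.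
have K0 : 0 < 1 + K by rewrite ltr_wpDr.
apply: le_trans (bound (e / (1 + K)) _) _; first by rewrite divr_gt0.
rewrite -mulrA ler_piMr ?(ltW e0) // mulrC ler_pdivrMr // mul1r lerDr //.
Qed.

End Topology.

(** * Quotients that extend to the polydisc *)

Section Quotients.
Variables (R : realType) (n : nat).
Local Notation C := R[i].
Implicit Types (P Q S : mpoly n C) (z w : 'rV[C]_n) (f g : 'rV[C]_n -> C).

Lemma mpoly_fieldP (c : C) : c != 0 -> c \is a GRing.unit.
Proof. by rewrite unitfE. Qed.

(** Eliminating the j-th variable produces r = u Q + v S, free of that variable,
    such that Q has no zeros on the slices of the polydisc in the direction j on
    which r is nonzero. These slices are dense, and Harnack's inequality passes
    to the limit: on any slice through a zero, Q vanishes identically. *)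
Lemma zero_spreads Q S f z j x : Q != 0 ->
  (forall w, polydisc w -> f w * peval Q w = peval S w) ->
  no_common_irreducible_factor Q S -> polydisc z -> peval Q z = 0 ->
  peval Q (z + x *: delta_mx ord0 j) = 0.
Proof.
move=> Q0 fQ cop Dz Qz.
have [r [u [v [r0 er rj]]]] := eliminate_variable mpoly_fieldP j Q0 cop.
pose d : C := (1 - `|z ord0 j|) / 2.
have d0 : 0 < d by rewrite divr_gt0 // subr_gt0 Dz.
have zd : `|z ord0 j| < 1 - d.
  have e1 : 1 - d - `|z ord0 j| = d by rewrite /d; field.
  by rewrite -subr_gt0 e1.
pose e := d *: (delta_mx ord0 j : 'rV[C]_n).
have -> : x *: delta_mx ord0 j = (x / d) *: e.
  by rewrite scalerA divfK // lt0r_neq0.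
move: (x / d) => {}x; apply/eqP; apply: contraT => Qe.
pose a := `|peval Q (z + x *: e)|; pose K := (1 + `|x|) ^+ msize Q.
have a0 : 0 < a by rewrite normr_gt0.
have a2 : 0 < a / 2 by rewrite divr_gt0.
move: r0; rewrite (_ : r = 0) ?eqxx //; apply: (@peval_near0 _ _ _ z).
have near1 : \forall w \near z, `|K * peval Q w| < a / 2.
  have l : K * peval Q w @[w --> z] --> K * peval Q z.
    apply: (@cvgM _ _ (nbhs z) _ (fun=> K)); first exact: cvg_cst.
    exact: peval_continuous.
  by apply: (cvgr_norm_lt _ l); rewrite Qz mulr0 normr0.
have near2 : \forall w \near z, a / 2 < `|peval Q (w + x *: e)|.
  have l : w + x *: e @[w --> z] --> z + x *: e.
    by apply: (@cvgD C _ _ (nbhs z) _ id (fun=> x *: e)); [exact: cvg_id|exact: cvg_cst].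
  have l2 : peval Q (w + x *: e) @[w --> z] --> peval Q (z + x *: e).
    exact: (cvg_comp _ _ l (@peval_continuous _ _ Q _)).
  by apply: (cvgr_norm_gt _ l2); rewrite ltr_pdivrMr // ltr_pMr // ltr1n.
have near3 : \forall w \near z, [set w : 'rV[C]_n | `|w ord0 j| < 1 - d] w.
  exact: (cvgr_norm_lt (z ord0 j) (@coord_continuous _ _ _ ord0 j z) _ zd).
near=> w; apply/eqP; apply: contraT => rw.
have Dw : polydisc w by near: w; exact: near_polydisc.
have w1 : `|K * peval Q w| < a / 2 by near: w.
have w2 : a / 2 < `|peval Q (w + x *: e)| by near: w.
have w3 : `|w ord0 j| < 1 - d by near: w.
have : `|peval Q (w + x *: e)| <= K * `|peval Q w|.
  apply: harnack_line => y y1; apply: contraNneq rw => Qy.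
  have Dy : polydisc (w + y *: e).
    move=> k; rewrite !mxE; have [->|kj] := eqVneq k j; last first.
      by rewrite !mulr0 addr0.
    rewrite mulr1; apply: le_lt_trans (ler_normD _ _) _.
    rewrite -[1](subrK d); apply: ltr_leD => //.
    by rewrite normrM (gtr0_norm d0) ler_piMl // ltW.
  have -> : peval r w = peval r (w + y *: e).
    apply: rj => k kj; rewrite !mxE (negbTE kj) andbF.
    by rewrite !mulr0 addr0.
  rewrite er pevalD !pevalM -(fQ _ Dy) Qy.
  by rewrite !mulr0 addr0.
rewrite -[K](@ger0_norm _ K) ?exprn_ge0 ?addr_ge0 // -normrM => h.
by have := lt_trans (le_lt_trans h w1) w2; rewrite ltxx.
Unshelve. all: by end_near. Qed.

(** From a zero of Q one reaches any point w of the polydisc by replacing the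
    coordinates one at a time, and Q still vanishes there. *)
Lemma zero_free_quotient Q S f : Q != 0 ->
  (forall w, polydisc w -> f w * peval Q w = peval S w) ->
  no_common_irreducible_factor Q S -> zero_free_on_polydisc Q.
Proof.
move=> Q0 fQ cop; apply/zero_freeP => z Dz; apply/eqP => Qz.
move: (Q0); apply/negP; rewrite negbK; apply/eqP; apply: peval_polydisc_inj => w Dw.
rewrite [peval 0 w]meval0.
pose h k : 'rV[C]_n := \row_j if (j < k)%N then w ord0 j else z ord0 j.
have Dh k : polydisc (h k) by move=> j; rewrite mxE; case: ifP.
have -> : w = h n by apply/rowP => j; rewrite mxE ltn_ord.
suff H k : (k <= n)%N -> peval Q (h k) = 0 by exact: H.
elim: k => [_|k IH kn].
  by rewrite (_ : h 0%N = z) //; apply/rowP => j; rewrite mxE.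
have -> : h k.+1 = h k +
    (w ord0 (Ordinal kn) - z ord0 (Ordinal kn)) *: delta_mx ord0 (Ordinal kn).
  apply/rowP => j; rewrite !mxE eqxx /= -val_eqE /= ltnS leq_eqVlt.
  case: ltngtP => //= [_|_|jk]; rewrite ?mulr0 ?addr0 // mulr1 addrC.
  by rewrite (_ : j = Ordinal kn) ?subrK //; exact: val_inj.
exact: (zero_spreads _ _ Q0 fQ cop (Dh k) (IH (ltnW kn))).
Qed.

Lemma cvg_real_complex : r%:C @[r --> (1 : R)] --> (1 : C).
Proof.
apply/cvgrPdist_lt => e e0.
have Re0 : 0 < complex.Re e by move: e0; rewrite ltcE => /andP[].
have -> : e = (complex.Re e)%:C by rewrite RRe_real // gtr0_real.
near=> r; rewrite -[1]/((1 : R)%:C) -rmorphB normc_def /= expr0n addr0 sqrtr_sqr.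
rewrite ltcR; near: r.
exact: (@cvgr_dist_lt _ _ _ (nbhs (1 : R)) _ id 1 (@cvg_id _ _)).
Unshelve. all: by end_near. Qed.

Lemma radial_cvg P w :
  peval P (r%:C *: w) @[r --> (1 : R)^'-] --> peval P w.
Proof.
apply: cvg_at_left_filter.
apply: (@cvg_comp _ _ _ (fun r : R => r%:C *: w) (peval P)); last first.
  exact: peval_continuous.
rewrite -{2}[w]scale1r.
by apply: (@cvgZr_tmp C _ R (nbhs (1 : R)) _ (fun r => r%:C)); exact: cvg_real_complex.
Qed.

Lemma near_radial_polydisc t :
  \forall r \near (1 : R)^'-, polydisc (r%:C *: @torus_point R n t).
Proof.
near=> r => j; rewrite !mxE normrM norm_circle_point mulr1.
have r0 : 0 < r by near: r; exact: nbhs_left_gt.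
have r1 : r < 1 by near: r; exact: nbhs_left_lt.
by rewrite normc_def /= expr0n addr0 sqrtr_sqr gtr0_norm // ltcR.
Unshelve. all: by end_near. Qed.

(** The equation f Q = P passes to the radial limits. *)
Lemma inner_norm_eq f P Q : inner f ->
  (forall z, polydisc z -> f z * peval Q z = peval P z) ->
  {ae torus_prob R n, forall t,
     `|peval P (torus_point t)| = `|peval Q (torus_point t)|}.
Proof.
move=> [_ _ f1] fQ; apply: filterS f1 => t f1.
have lQ := @cvg_norm _ _ _ _ (at_left_proper_filter (1:R)) _ _ (@radial_cvg Q (torus_point t)).
have lP := @cvg_norm _ _ _ _ (at_left_proper_filter (1:R)) _ _ (@radial_cvg P (torus_point t)).
have lfQ := cvgM f1 lQ; rewrite mul1r in lfQ.
apply: (norm_cvg_unique lP).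
suff lP2 : `|peval P (r%:C *: torus_point t)| @[r --> (1 : R)^'-] -->
    `|peval Q (torus_point t)| by exact: lP2.
move=> U /lfQ; apply: (@filterS2 _ (1 : R)^'- _ _ _ _ _ (near_radial_polydisc t)).
by move=> r Dr /=; rewrite -normrM fQ.
Qed.

(** The quotient has modulus at most 1 on the polydisc, and it extends
    continuously, with modulus 1, to the points of the torus where P does not
    vanish, that is to almost all of them. *)
Lemma reflection_quotient_rational_inner (c : C) P : `|c| = 1 ->
  zero_free_on_polydisc P ->
  rational_inner (fun z => c * (peval (reflection P) z / peval P z)).
Proof.
move=> c1 Pz; have /zero_freeP Pnz := Pz.
have P0 : P != 0.
  by apply: contra_neq (zero_free_coef0 Pz) => ->; rewrite mcoeff0.
split; last first.
  by exists (c *: reflection P), P; split=> // z Dz _; rewrite pevalZ mulrA.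
split.
- move=> z Dz; apply: differentiableM; first exact: differentiable_cst.
  apply: differentiableM; first exact: peval_differentiable.
  by apply: differentiableV; [exact: peval_differentiable | exact: Pnz].
- exists 1 => z Dz; rewrite !normrM c1 mul1r normfV ler_pdivrMr ?normr_gt0 ?Pnz //.
  by rewrite mul1r norm_reflection_le.
have Pt : {ae torus_prob R n, forall t, peval P (torus_point t) != 0}.
  exists [set t | peval P (torus_point t) = 0]; split.
  - exact/measurable_zero_set/complex_measurable_peval.
  - exact: torus_null.
  - by move=> t /=; rewrite /setC /= => /negP; rewrite negbK => /eqP.
apply: filterS Pt => t Pt.
have := norm_reflection_torus P (fun j => _ : `|torus_point t ord0 j| = 1).
move=> /(_ _) nr; have {}nr : `|peval (reflection P) (torus_point t)| =
    `|peval P (torus_point t)| by apply: nr => j; rewrite mxE norm_circle_point.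
have -> : 1 = `|c * (peval (reflection P) (torus_point t) /
    peval P (torus_point t))|.
  by rewrite !normrM c1 mul1r normfV nr divff // normr_eq0.
apply: cvg_norm; apply: cvgM; first exact: cvg_cst.
apply: cvgM; first exact: radial_cvg.
by apply: cvgV => //; exact: radial_cvg.
Qed.

End Quotients.

(** * Rational inner functions *)

Section RationalInner.
Variables (R : realType) (n : nat).
Local Notation C := R[i].
Implicit Types (P Q S a b d p q : mpoly n C) (z w : 'rV[C]_n)
  (f g : 'rV[C]_n -> C).

Lemma factorial_mpolyC : factorial_ring (mpoly n C).
Proof. exact: factorial_mpoly (@mpoly_fieldP R) n. Qed.

Lemma mpolyC_neq0_unit (c : C) : c != 0 ->
  mpolyC n c \is a @GRing.unit (mpoly n C).
Proof. exact: mpolyC_unit (@mpoly_fieldP R) n c. Qed.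

Lemma unit_mpolyCP p : p \is a GRing.unit -> exists2 c : C, c != 0 & p = mpolyC n c.
Proof. exact: unit_mpolyC. Qed.

Lemma nonconstant_nonunit P : nonconstant_poly P -> P \isn't a GRing.unit.
Proof. by move=> nc; apply/negP => /unit_mpolyCP[c _ e]; apply: nc; exists c. Qed.

Lemma msize_ltM a b : a != 0 -> b != 0 -> a \isn't a GRing.unit ->
  (msize b < msize (a * b))%N.
Proof.
move=> a0 b0 nua; have dN := additive_degree_msize (@mpoly_fieldP R) n.
have := nonunit_degree dN a0 nua; rewrite msizeM //.
by case: (msize a) => [//|[//|k]] _; rewrite addSn /= addSn ltnS leq_addl.
Qed.

Lemma exists_irreducible_factor p : p != 0 -> p \isn't a GRing.unit ->
  exists d, irreducible_elt d /\ divides d p.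
Proof.
exact: exists_irreducible_divisor (additive_degree_msize (@mpoly_fieldP R) n).
Qed.

Lemma zero_free_neq0 P : zero_free_on_polydisc P -> P != 0.
Proof. by move=> /zero_free_coef0; apply: contra_neq => ->; rewrite mcoeff0. Qed.

Lemma zero_free_divides a P : divides a P -> zero_free_on_polydisc P ->
  zero_free_on_polydisc a.
Proof.
move=> [b ->] /zero_freeP ab; apply/zero_freeP => z /ab.
by rewrite pevalM mulf_eq0 negb_or => /andP[].
Qed.

(** A divisor d of a monomial has a constant reflection, since a monomial reflects
    to 1; if d(0) <> 0 then d is constant. *)
Lemma no_common_monomial q (m : multinom n) : mcoeff (@mnm0 n) q != 0 ->
  no_common_irreducible_factor q (mpolyX C m).
Proof.
move=> q0 d [_ nud _] [[x ex] [e ee]].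
have d0 : mcoeff (@mnm0 n) d != 0.
  by apply: contra q0; rewrite ex -!peval0 pevalM => /eqP ->; rewrite mul0r.
have r1 : reflection (mpolyX C m) = 1.
  apply: torus_ext => w w1; rewrite reflection_torus // nuX monomial_torus //.
  by rewrite /peval meval1.
have : reflection d \is a GRing.unit.
  apply: (@divides_unit _ _ 1); last exact: unitr1.
  by rewrite -r1 ee reflectionM; exists (reflection e).
move=> /unit_mpolyCP[c c0 ed]; move/negP: nud; apply.
by rewrite -(reflectionK d0) ed reflectionC mpolyC_neq0_unit // conjC_eq0.
Qed.

Lemma quotient_cancel f d p q : holomorphic f -> d != 0 ->
  (forall z, polydisc z -> f z * peval (d * q) z = peval (d * p) z) ->
  forall z, polydisc z -> f z * peval q z = peval p z.
Proof.
move=> hf d0 H z Dz.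
apply: (continuous_eq_off_zeros (f := fun z => f z * peval q z) d0 Dz).
- apply: (@cvgM _ _ (nbhs z) _ f (peval q)).
    exact: holomorphic_continuous.
  exact: peval_continuous.
- exact: peval_continuous.
move=> w Dw dw; apply: (mulfI dw).
by rewrite mulrCA -!pevalM H.
Qed.

Lemma lowest_terms f : holomorphic f -> Defs.rational f -> exists p q,
  [/\ q != 0, forall z, polydisc z -> f z * peval q z = peval p z &
      no_common_irreducible_factor q p].
Proof.
move=> hf [p [q [q0 fpq]]].
have {fpq} : forall z, polydisc z -> f z * peval q z = peval p z.
  apply: (quotient_cancel hf q0) => z Dz; rewrite !pevalM.
  have [->|qz] := eqVneq (peval q z) 0; first by rewrite !mul0r mulr0.
  by rewrite fpq // mulrCA divfK.
have [k] := ubnP (msize q); elim: k p q q0 => // k IH p q q0 sq fq.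
have [cop|] := pselect (no_common_irreducible_factor q p).
  by exists p, q.
move=> /existsNP[d /not_implyP[[d0 nud _] /contrapT[[q' eq] [p' ep]]]].
have q'0 : q' != 0 by move: q0; rewrite eq mulf_eq0 negb_or => /andP[].
apply: (IH p' q' q'0).
  by rewrite -ltnS; apply: leq_trans sq; rewrite eq ltnS msize_ltM.
by apply: (quotient_cancel hf d0); rewrite -eq -ep.
Qed.

End RationalInner.

Section NormalForm.
Variables (R : realType) (n : nat).
Local Notation C := R[i].
Implicit Types (P Q S a b d p q : mpoly n C) (z w : 'rV[C]_n)
  (f g : 'rV[C]_n -> C).

Lemma mul_cancel_middle (A : idomainType) (x y a b e r : A) : b != 0 ->
  x * (a * (b * e)) = y * (b * r) -> x * (a * e) = y * r.
Proof.
move=> b0 E; apply: (mulfI b0); rewrite [RHS]mulrCA -E [LHS]mulrCA.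
by congr (_ * _); exact: mulrCA.
Qed.

(** If p/q is in lowest terms, then |p| = |q| on the torus reads
    z^nu(q) p p~ = z^nu(p) q q~, with ~ the reflection, and so q divides p~.
    Degrees leave no room for a nonconstant cofactor. *)
Lemma same_torus_norm_normal_form p q : q != 0 -> p != 0 ->
  mcoeff (@mnm0 n) q != 0 -> no_common_irreducible_factor q p ->
  mpolyX C (nu q) * (p * reflection p) = mpolyX C (nu p) * (q * reflection q) ->
  exists (k : C) (m : multinom n), k != 0 /\ k *: p = mpolyX C m * reflection q.
Proof.
move=> q0 p0 q00 cop E.
have [e ee] : divides q (reflection p).
  apply: (coprime_divides (factorial_mpolyC R n) q0 cop).
  apply: (coprime_divides (factorial_mpolyC R n) q0 (no_common_monomial (m := nu q) q00)).
  by rewrite E; apply/dividesMl/dividesMr/divides_refl.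
have e0 : e != 0.
  by have := reflection_neq0 p0; rewrite ee mulf_eq0 negb_or => /andP[].
have E2 : mpolyX C (nu q) * (p * e) = mpolyX C (nu p) * reflection q.
  by apply: (mul_cancel_middle q0); rewrite -E ee.
have nue : nu e = @mnm0 n.
  have e1 : nu (mpolyX C (nu q) * (p * e)) = mnm_add (nu q) (mnm_add (nu p) (nu e)).
    by rewrite (nuM (mpolyX_neq0 _ _) (mulf_neq0 p0 e0)) (nuM p0 e0) nuX.
  have e2 : nu (mpolyX C (nu p) * reflection q) = mnm_add (nu p) (nu q).
    by rewrite (nuM (mpolyX_neq0 _ _) (reflection_neq0 q0)) nuX nu_reflection.
  have cancel (a b c : nat) : (a + (b + c) = b + a)%N -> c = 0%N.
    by move=> /eqP; rewrite addnCA eqn_add2l -{2}[a]addn0 eqn_add2l => /eqP.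
  apply/mnmP => j; rewrite mnm0E; apply: (cancel (nu q j) (nu p j)).
  by rewrite -!mnmDE -e1 E2 e2.
have ek := nu0_const nue; move: (mcoeff _ e) ek => k ek.
have k0 : k != 0 by apply: contra_neq e0 => k0; rewrite ek k0 mpolyC0.
exists k, (mnm_sub (nu p) (nu q)); split; first exact: k0.
have nuq : mnm_add (nu q) (mnm_sub (nu p) (nu q)) = nu p.
  apply/mnmP => j; rewrite mnmDE mnmBE subnKC //.
  apply: leq_trans (nu_reflection_le p j).
  by rewrite ee (nuM q0 e0) mnmDE nue mnm0E addn0.
apply: (mulfI (mpolyX_neq0 _ (nu q))).
rewrite mulrA -mpolyXD nuq -E2 ek -mul_mpolyC [p * _]mulrC.
by [].
Qed.

(** Rudin's theorem. In lowest terms the denominator is zero-free, and numerator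
    and denominator have the same modulus on the torus. *)
Lemma rational_inner_normal_form f : rational_inner f ->
  exists (c : C) (m : multinom n) q, [/\ c != 0, zero_free_on_polydisc q,
    no_common_irreducible_factor q (mpolyX C m * reflection q) &
    forall z, polydisc z ->
      f z * peval q z = c * peval (mpolyX C m * reflection q) z].
Proof.
move=> [fi fr]; have [hf _ _] := fi.
have [p [q [q0 fq cop]]] := lowest_terms hf fr.
have qz := zero_free_quotient q0 fq cop.
have q00 := zero_free_coef0 qz.
have E : mpolyX C (nu q) * (p * reflection p) =
    mpolyX C (nu p) * (q * reflection q).
  apply/eqP; rewrite -subr_eq0; apply/eqP/ae_torus_eq0.
  apply: filterS (inner_norm_eq fi fq) => t pq.
  have t1 j : `|torus_point t ord0 j| = 1 by rewrite mxE norm_circle_point.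
  have Nc := congr1 (fun x => x ^+ 2) pq; rewrite /= !normCK in Nc.
  have alg (x y u u' v v' : C) : u * u' = v * v' ->
      x * (u * (y * u')) = y * (v * (x * v')).
    by move=> uv; rewrite [u * _]mulrCA uv [v * (x * _)]mulrCA; exact: mulrCA.
  apply/eqP; rewrite pevalB subr_eq0 !pevalM; apply/eqP.
  by rewrite (reflection_torus p t1) (reflection_torus q t1); exact: alg.
have p0 : p != 0.
  apply: contra_eq_neq E => ->; rewrite mul0r mulr0 eq_sym.
  by rewrite !mulf_neq0 // ?mpolyX_neq0 // reflection_neq0.
have [k [m [k0 Ep]]] := same_torus_norm_normal_form q0 p0 q00 cop E.
exists k^-1, m, q; split.
- by rewrite invr_eq0.
- exact: qz.
- rewrite -Ep; apply: no_commonS cop; first exact: divides_refl.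
  exists (mpolyC n k^-1).
  by rewrite mulrC mul_mpolyC scalerA mulVf // scale1r.
- by move=> z Dz; rewrite fq // -Ep pevalZ mulKf.
Qed.

(** A common irreducible factor d of P and its reflection always cancels together
    with a factor of the reflection, leaving an expression of the same form with a
    denominator of lower degree. *)
Lemma unimodular_expression_reduces f P (c : C) : ~ constant_on_polydisc f ->
  zero_free_on_polydisc P -> `|c| = 1 ->
  (forall z, polydisc z -> f z = c * (peval (reflection P) z / peval P z)) ->
  exists P', reduced_expression f P'.
Proof.
move=> fnc; have [k] := ubnP (msize P); elim: k P c => // k IH P c sP Pz c1 fP.
have c0 : c != 0 by rewrite -normr_eq0 c1 oner_eq0.
have [cop|] := pselect (no_common_irreducible_factor (c *: reflection P) P).
  exists P; split => //; last by exists c.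
  move=> [x ex]; apply: fnc; exists (c * (Num.conj x / x)) => z Dz.
  by rewrite fP // ex reflectionC !pevalC.
move=> /existsNP[d /not_implyP[dd /contrapT[dr [a ea]]]].
have [d0 nud _] := dd.
have {}dr : divides d (reflection P).
  apply: divides_trans dr _; exists (mpolyC n c^-1).
  by rewrite -mul_mpolyC mulrAC -mpolyCM mulfV // mpolyC1 mul1r.
have Pnz := (zero_freeP P).1 Pz.
have dz : zero_free_on_polydisc d by apply: zero_free_divides Pz; exists a.
have az : zero_free_on_polydisc a.
  by apply: zero_free_divides Pz; exists d; rewrite mulrC.
have dnz := (zero_freeP d).1 dz; have anz := (zero_freeP a).1 az.
have d00 := zero_free_coef0 dz; have a00 := zero_free_coef0 az.
have rP : reflection P = reflection d * reflection a by rewrite ea reflectionM.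
have [[e ee]|[b eb]] : divides d (reflection d) \/ divides d (reflection a).
  by apply: (factorial_mpolyC R n).2 => //; rewrite -rP.
(* If d divides its own reflection, of the same degree, they are proportional. *)
- have e0 : e != 0.
    by have := reflection_neq0 d0; rewrite ee mulf_eq0 negb_or => /andP[].
  have nue : nu e = @mnm0 n.
    have := congr1 (@nu _ _) ee; rewrite nu_reflection // nuM // => /mnmP h.
    apply/mnmP => j; have := h j; rewrite mnmDE mnm0E => /eqP.
    by rewrite -{1}[nu d j]addn0 eqn_add2l => /eqP.
  have ex := nu0_const nue; set x := mcoeff _ e in ex.
  have x1 : `|x| = 1.
    have := reflectionK d00; rewrite {1}ee reflectionM ex reflectionC ee ex.
    rewrite -mulrA -mpolyCM -normCK -[in RHS](mulr1 d) -(mpolyC1 n).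
    move=> /(mulfI d0).
    by move=> /(congr1 (mcoeff (@mnm0 n))); rewrite !mcoeffC eqxx !mulr1 => /eqP; rewrite sqrp_eq1 // => /eqP.
  apply: (IH a (c * x)) => //.
  + rewrite -ltnS; apply: leq_trans sP.
    by rewrite ea ltnS msize_ltM // zero_free_neq0.
  + by rewrite normrM c1 x1 mulr1.
  move=> z Dz; rewrite fP // rP ea ee ex !pevalM pevalC.
  by have := dnz z Dz; have := anz z Dz => *; field; apply/andP.
(* Otherwise the reflection of d divides a, and the product of d and its
   reflection cancels from both P and its reflection. *)
have ea2 : a = reflection d * reflection b.
  by rewrite -(reflectionK a00) eb reflectionM.
have bb : reflection (reflection b) = b.
  by apply: (mulfI d0); rewrite -eb ea2 reflectionM (reflectionK d00).
have rdz : zero_free_on_polydisc (reflection d).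
  by apply: zero_free_divides az; exists (reflection b).
have rbz : zero_free_on_polydisc (reflection b).
  by apply: zero_free_divides az; exists (reflection d); rewrite mulrC.
apply: (IH (reflection b) c) => //.
  rewrite -ltnS; apply: leq_trans sP; rewrite ea ltnS.
  apply: (@leq_ltn_trans (msize a)); last by rewrite msize_ltM // zero_free_neq0.
  rewrite ea2 msizeM ?(zero_free_neq0 rdz) ?(zero_free_neq0 rbz) //.
  have := zero_free_neq0 rdz; rewrite -msize_poly_eq0.
  by case: (msize (reflection d)) => // l _; rewrite addSn leq_addl.
move=> z Dz; rewrite fP // rP eb ea ea2 bb !pevalM.
have := dnz z Dz; have := (zero_freeP _).1 rdz z Dz.
have := (zero_freeP _).1 rbz z Dz => h1 h2 h3; field.
by apply/and3P.
Qed.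

(** If the quotient were a unit, then the reflection of a would be zero-free,
    so that a and its reflection would have the same modulus and hence be
    proportional. *)
Lemma reflection_quotient_nonunit a (c : C) : zero_free_on_polydisc a ->
  a \isn't a GRing.unit -> no_common_irreducible_factor (reflection a) a ->
  ~ unit_holomorphic (fun z => c * (peval (reflection a) z / peval a z)).
Proof.
move=> az nua cop [_ [g [_ gu]]].
have raz : zero_free_on_polydisc (reflection a).
  apply/zero_freeP => z Dz; apply/eqP => e; have := gu z Dz.
  by rewrite e !(mul0r, mulr0) => /esym/eqP; rewrite oner_eq0.
have [k ek] : exists k, reflection a = k *: a.
  apply: zero_free_same_norm => // z Dz; apply: le_anti.
  rewrite norm_reflection_le //=; have := norm_reflection_le raz Dz.
  by rewrite reflectionK // zero_free_coef0.
have [d [dd da]] := exists_irreducible_factor (zero_free_neq0 az) nua.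
apply: (cop d dd); split => //.
by rewrite ek -mul_mpolyC; exact: dividesMl.
Qed.

(** The product of the normal forms of f1 and f2 is C P~ / P in lowest terms;
    once P cancels against the denominator q1 = P s, what remains forces s and
    the reflection of q2 to be proportional, so that f2 is a unit. *)
Lemma irreducible_divides_factor f2 P (c c1 c2 : C) (m1 m2 : multinom n) q1 q2 :
  zero_free_on_polydisc P -> c != 0 -> c1 != 0 -> c2 != 0 ->
  zero_free_on_polydisc q1 -> zero_free_on_polydisc q2 ->
  no_common_irreducible_factor q1 (mpolyX C m1 * reflection q1) ->
  no_common_irreducible_factor q2 (mpolyX C m2 * reflection q2) ->
  holomorphic f2 ->
  (forall z, polydisc z ->
     f2 z * peval q2 z = c2 * peval (mpolyX C m2 * reflection q2) z) ->
  c *: (reflection P * (q1 * q2)) =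
    (c1 * c2) *:
      (P * (mpolyX C m1 * reflection q1 * (mpolyX C m2 * reflection q2))) ->
  divides P q1 -> unit_holomorphic f2.
Proof.
move=> Pz c0 c10 c20 q1z q2z cop1 cop2 hf2 f2q E [s es].
have sz : zero_free_on_polydisc s.
  by apply: zero_free_divides q1z; exists P; rewrite mulrC.
have [[P0 s0] q20] := (zero_free_neq0 Pz, zero_free_neq0 sz, zero_free_neq0 q2z).
have E2 : c *: (s * q2) = (c1 * c2) *:
    (mpolyX C (mnm_add m1 m2) * (reflection s * reflection q2)).
  apply: (mulfI (mulf_neq0 P0 (reflection_neq0 P0))).
  rewrite -!scalerAr.
  transitivity (c *: (reflection P * (q1 * q2))).
    by rewrite es; congr (_ *: _); ring.
  by rewrite E es reflectionM mpolyXD; congr (_ *: _); ring.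
have m0 : mnm_add m1 m2 = @mnm0 n.
  have := congr1 (@nu _ _) E2; rewrite -!mul_mpolyC.
  rewrite !nuM ?mulf_neq0 ?mpolyX_neq0 ?reflection_neq0 ?mpolyC_eq0 ?mulf_neq0 //.
  rewrite !nu_mpolyC nuX !nu_reflection ?zero_free_coef0 // => /mnmP h.
  apply/mnmP => j; have := h j; rewrite !mnmDE !mnm0E !add0n => /eqP.
  by rewrite -{1}[(_ + _)%N]add0n eqn_add2r => /eqP <-.
have m20 : mpolyX C m2 = 1.
  rewrite (_ : m2 = @mnm0 n) ?mpolyX0 //; apply/mnmP => j; move/mnmP/(_ j): m0.
  by rewrite mnmDE mnm0E => /eqP; rewrite addn_eq0 => /andP[_ /eqP].
rewrite m0 mpolyX0 mul1r in E2; rewrite m20 mul1r in cop2 f2q.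
have sE x : x != 0 -> forall p, p = mpolyC n x^-1 * (x *: p).
  by move=> x0 p; rewrite mul_mpolyC scalerA mulVf // scale1r.
have [y ey] : divides q2 (reflection s).
  apply: (coprime_divides (factorial_mpolyC R n) q20 cop2).
  rewrite mulrC (sE _ (mulf_neq0 c10 c20) (_ * _)) -E2 -mul_mpolyC.
  by apply/dividesMl/dividesMl/dividesMl/divides_refl.
have [x ex] : divides s (reflection q2).
  apply: (@coprime_divides _ s (reflection s) _ (factorial_mpolyC R n) s0).
    apply: no_commonS cop1; first by exists P; rewrite mulrC.
    by rewrite es reflectionM; apply/dividesMl/dividesMl/divides_refl.
  rewrite (sE _ (mulf_neq0 c10 c20) (_ * _)) -E2 -mul_mpolyC.
  by apply/dividesMl/dividesMl/dividesMr/divides_refl.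
have uy : y \is a GRing.unit.
  have e1 : q2 * (y * reflection x) = q2 * 1.
    by rewrite mulr1 mulrA -ey -reflectionM -ex reflectionK // zero_free_coef0.
  by apply: (@divides_unit _ _ 1 _ (unitr1 _)); exists (reflection x);
    rewrite (mulfI q20 e1).
have [k k0 ek] := unit_mpolyCP uy.
have es2 : s = reflection q2 * mpolyC n (Num.conj k).
  by rewrite -(reflectionK (zero_free_coef0 sz)) ey ek reflectionM reflectionC.
have rq2nz z : polydisc z -> peval (reflection q2) z != 0.
  move=> Dz; have := (zero_freeP s).1 sz z Dz.
  by rewrite es2 pevalM mulf_eq0 negb_or => /andP[].
split => //; exists (fun z => peval q2 z * (c2 * peval (reflection q2) z)^-1).
split=> [z Dz|z Dz].
  apply: differentiableM; first exact: peval_differentiable.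
  apply: differentiableV; last by rewrite mulf_neq0 ?rq2nz.
  by apply: differentiableM; [exact: differentiable_cst|exact: peval_differentiable].
by rewrite mulrA f2q // mulfV // mulf_neq0 ?rq2nz.
Qed.

End NormalForm.

(** * Factorizations *)

Section Factorizations.
Variables (R : realType) (n : nat).
Local Notation C := R[i].
Implicit Types (P : mpoly n C) (f : 'rV[C]_n -> C).

Lemma no_common_scale P (c : C) : c != 0 ->
  no_common_irreducible_factor (c *: reflection P) P ->
  no_common_irreducible_factor (reflection P) P.
Proof.
move=> c0; apply: no_commonS (divides_refl P); exists (mpolyC n c).
by rewrite mulrC mul_mpolyC.
Qed.

Lemma reducible_factorization f P : reduced_expression f P -> reducible_elt P ->
  exists f1 f2 : 'rV[C]_n -> C,
    [/\ rational_inner f1, rational_inner f2,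
        ~ unit_holomorphic f1, ~ unit_holomorphic f2 &
        forall z, polydisc z -> f z = f1 z * f2 z].
Proof.
move=> [_ Pz [c [c1 fP cop]]] [_ _ [a [b [nua nub eP]]]].
have c0 : c != 0 by rewrite -normr_eq0 c1 oner_eq0.
have {}cop := no_common_scale c0 cop.
have az : zero_free_on_polydisc a by apply: zero_free_divides Pz; exists b.
have bz : zero_free_on_polydisc b.
  by apply: zero_free_divides Pz; exists a; rewrite mulrC.
have copa : no_common_irreducible_factor (reflection a) a.
  apply: no_commonS cop; rewrite eP; last by exists b.
  by exists (reflection b); rewrite reflectionM.
have copb : no_common_irreducible_factor (reflection b) b.
  apply: no_commonS cop; rewrite eP; last by exists a; rewrite mulrC.
  by exists (reflection a); rewrite reflectionM mulrC.
exists (fun z => c * (peval (reflection a) z / peval a z)).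
exists (fun z => 1 * (peval (reflection b) z / peval b z)).
split.
- exact: reflection_quotient_rational_inner.
- by apply: reflection_quotient_rational_inner => //; exact: normr1.
- exact: reflection_quotient_nonunit.
- exact: reflection_quotient_nonunit.
move=> z Dz; rewrite fP // eP reflectionM !pevalM mul1r -[RHS]mulrA.
by congr (_ * _); rewrite invfM mulrACA.
Qed.

Lemma factorization_reducible f f1 f2 P : reduced_expression f P ->
  rational_inner f1 -> rational_inner f2 ->
  ~ unit_holomorphic f1 -> ~ unit_holomorphic f2 ->
  (forall z, polydisc z -> f z = f1 z * f2 z) -> reducible_elt P.
Proof.
move=> [Pnc Pz [c [c1 fP cop]]] r1 r2 nu1 nu2 ff.
have c0 : c != 0 by rewrite -normr_eq0 c1 oner_eq0.
have {}cop := no_common_scale c0 cop.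
have P0 := zero_free_neq0 Pz; have nuP := nonconstant_nonunit Pnc.
apply: contrapT => nred.
have irr : irreducible_elt P.
  split => // a b e.
  have [ua|nua] := boolP (a \is a GRing.unit); first by left.
  have [ub|nub] := boolP (b \is a GRing.unit); first by right.
  by case: nred; split => //; exists a, b.
have [k1 [m1 [q1 [k10 q1z cop1 fq1]]]] := rational_inner_normal_form r1.
have [k2 [m2 [q2 [k20 q2z cop2 fq2]]]] := rational_inner_normal_form r2.
have hf1 : holomorphic f1 by case: r1 => -[].
have hf2 : holomorphic f2 by case: r2 => -[].
have E : c *: (reflection P * (q1 * q2)) = (k1 * k2) *: (P *
    (mpolyX C m1 * reflection q1 * (mpolyX C m2 * reflection q2))).
  apply: peval_polydisc_inj => z Dz.
  rewrite !pevalZ (pevalM (reflection P)) (pevalM q1) (pevalM P).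
  rewrite (pevalM (mpolyX C m1 * _)).
  have Pz0 := (zero_freeP P).1 Pz z Dz.
  have := fP z Dz; rewrite ff // => e.
  have {e} e : c * peval (reflection P) z = peval P z * (f1 z * f2 z).
    by rewrite e mulrCA [peval P z * _]mulrC divfK.
  rewrite [LHS]mulrA e.
  transitivity (peval P z * ((f1 z * peval q1 z) * (f2 z * peval q2 z))).
    by rewrite -[LHS]mulrA; congr (_ * _); exact: mulrACA.
  by rewrite fq1 // fq2 // [RHS]mulrCA; congr (_ * _); exact: mulrACA.
have : divides P (q1 * q2).
  apply: (coprime_divides (factorial_mpolyC R n) P0 (no_common_sym cop)).
  have -> : reflection P * (q1 * q2) =
      mpolyC n c^-1 * (c *: (reflection P * (q1 * q2))).
    by rewrite mul_mpolyC scalerA mulVf // scale1r.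
  by rewrite E -mul_mpolyC; apply/dividesMl/dividesMl/dividesMr/divides_refl.
case/((factorial_mpolyC R n).2 P irr) => [Pq1|Pq2].
  exact/nu2/(irreducible_divides_factor Pz c0 k10 k20 q1z q2z cop1 cop2
    hf2 fq2 E Pq1).
apply/nu1/(irreducible_divides_factor Pz c0 k20 k10 q2z q1z cop2 cop1
  hf1 fq1 _ Pq2).
by rewrite [q2 * q1]mulrC E [k2 * k1]mulrC; congr (_ *: (_ * _)); exact: mulrC.
Qed.

End Factorizations.

Theorem proposition2p2 (R : realType) (n : nat)
    (f : 'rV[R[i]]_n -> R[i]) (Q : mpoly n R[i])
    (f_inner : rational_inner f) (f_nonconstant : ~ constant_on_polydisc f)
    (Q_nonconstant : nonconstant_poly Q) (Q_zero_free : zero_free_on_polydisc Q)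
    (fQ : forall z, @polydisc R n z ->
       f z = peval (reflection Q) z / peval Q z) :
  (exists P : mpoly n R[i], reduced_expression f P) /\
  (forall P : mpoly n R[i], reduced_expression f P ->
    ((exists f1 f2 : 'rV[R[i]]_n -> R[i],
       [/\ rational_inner f1, rational_inner f2,
           ~ unit_holomorphic f1, ~ unit_holomorphic f2 &
           forall z, @polydisc R n z -> f z = f1 z * f2 z])
     <-> reducible_elt P)).

Proof.
have fP z : @polydisc R n z -> f z = 1 * (peval (reflection Q) z / peval Q z).
  by move=> Dz; rewrite mul1r; exact: fQ.
split.
  exact: unimodular_expression_reduces f_nonconstant Q_zero_free (normr1 _) fP.
move=> P redP; split; last exact: reducible_factorization redP.
move=> [f1 [f2 [r1 r2 u1 u2 ff]]].
exact: factorization_reducible redP r1 r2 u1 u2 ff.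
Qed.
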